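(* Consider the incommensurate fractional optimal control problem $$J[x(\cdot),u(\cdot)]=\varphi(b,x(b))+\int_a^b L(t,x(t),u(t))\,dt\longrightarrow\max$$ over pairs $(x,u)$ with $x\in AC^{(\alpha)}([a,b],\mathbb{R}^n)$, $u\in L^\infty([a,b],\mathbb{R}^m)$, subject to $${}^{C}D^{(\alpha)}_{a^+}x(t)=f(t,x(t),u(t))\ \text{ for a.e. } t\in[a,b],\qquad x(a)=x_a,\qquad u(t)\in\Omega,$$ where the data $L,f,\varphi,\Omega$ satisfy the standing assumptions listed in the context. Let $u^*$ be an optimal control with corresponding optimal state trajectory $x^*$. Let $(\tau,v)\in\mathcal{L}[F(\cdot)]\times\Omega$, where $\mathcal{L}[F(\cdot)]$ is the set of all points of $[a,b)$ that are Lebesgue points of both $t\mapsto f(t,x^*(t),u^*(t))$ and $t\mapsto L(t,x^*(t),u^*(t))$. For $\theta\in[0,b-\tau)$ let $$u^\theta(t)=\begin{cases}u^*(t)&\text{if } t\notin[\tau,\tau+\theta),\\ v&\text{if } t\in[\tau,\tau+\theta),\end{cases}\qquad\text{for a.e. } t\in[a,b],$$ and let $x^\theta$ denote the corresponding state trajectory, that is, the solution of $${}^{C}D^{(\alpha)}_{a^+}x^\theta(t)=f(t,x^\theta(t),u^\theta(t)),\qquad x^\theta(a)=x_a.$$ Then $x^\theta$ converges uniformly to $x^*$ as $\theta$ tends to zero.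
   Context: Let $a<b$, and let $(\alpha)=(\alpha_1,\dots,\alpha_n)$ with each $\alpha_i\in(0,1)$. Riemann--Liouville integrals of order $\beta>0$: $I^\beta_{a^+}y(t)=\frac{1}{\Gamma(\beta)}\int_a^t(t-s)^{\beta-1}y(s)\,ds$ and $I^\beta_{b^-}y(t)=\frac{1}{\Gamma(\beta)}\int_t^b(s-t)^{\beta-1}y(s)\,ds$. Function spaces: $L^{\alpha_i}$ denotes the scalar space $\{y\in L^1([a,b],\mathbb{R}): I^{\alpha_i}_{a^+}y,\ I^{\alpha_i}_{b^-}y\in AC([a,b],\mathbb{R})\}$. $AC^{(\alpha)}([a,b],\mathbb{R}^n)$ is the set of absolutely continuous functions $x$ whose components can be represented as $x_i(t)=x_i(a)+I^{\alpha_i}_{a^+}g(t)$ and $x_i(t)=x_i(b)+I^{\alpha_i}_{b^-}g(t)$ for some functions $g\in L^{\alpha_i}$ (possibly different functions in the two representations). The left Caputo incommensurate derivative ${}^{C}D^{(\alpha)}_{a^+}x$ has components ${}^{C}D^{\alpha_i}_{a^+}x_i(t)=I^{1-\alpha_i}_{a^+}\left(\frac{d}{dt}x_i\right)(t)$. Standing assumptions on the data: $\Omega\subset\mathbb{R}^m$ is closed and $x_a\in\mathbb{R}^n$; $L:[a,b]\times\mathbb{R}^n\times\mathbb{R}^m\to\mathbb{R}$, $f:[a,b]\times\mathbb{R}^n\times\mathbb{R}^m\to\mathbb{R}^n$, $\varphi:[a,b]\times\mathbb{R}^n\to\mathbb{R}$, where: - $\varphi$ is of class $C^1$; - $L$ and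 $f$ are continuous in all three arguments and of class $C^1$ with respect to $x$, and in particular locally Lipschitz: for every compact $B\subset\mathbb{R}^n$ there is $K>0$ such that $|L(t,x,u)-L(t,y,u)|\le K\|x-y\|$ and $\|f(t,x,u)-f(t,y,u)\|\le K\|x-y\|$ for all $x,y\in B$, $t\in[a,b]$, $u\in\Omega$; - there is $N>0$ with $\left\|\frac{\partial L}{\partial x}(t,x,u)\right\|\le N$ and $\left\|\frac{\partial f}{\partial x}(t,x,u)\right\|\le N$ for all $(t,x)\in[a,b]\times\mathbb{R}^n$, $u\in\Omega$; - there is $M>0$ with $|L(t,x,u)|\le M$ and $\|f(t,x,u)\|\le M$ for all $(t,x)\in[a,b]\times\mathbb{R}^n$, $u\in\Omega$. A pair $(x^*,u^* )$ is optimal if it satisfies all the constraints of the problem and maximizes $J$ among all pairs satisfying them. *)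

(* Defs.v *)
From HB Require Import structures.
From mathcomp Require Import all_boot all_order all_algebra.
From mathcomp Require Import all_classical all_reals all_analysis.

Set Implicit Arguments.
Unset Strict Implicit.
Unset Printing Implicit Defensive.

Import Order.TTheory GRing.Theory Num.Theory.
Import numFieldNormedType.Exports.

Local Open Scope classical_set_scope.
Local Open Scope ring_scope.

(* Functions on [a, b] are represented by functions on R, of which only the
   values on [a, b] matter. Row vectors carry the sup norm; every condition
   below is invariant under a change of norm on R^n. *)

Local Notation leb R := (@lebesgue_measure R).

Definition ae_itv (R : realType) (a b : R) (P : R -> Prop) : Prop :=
  {ae leb R, forall t, t \in `[a, b] -> P t}.

Definition Gamma (R : realType) (beta : R) : R :=
  \int[leb R]_(s in `]0, +oo[) (s `^ (beta - 1) * expR (- s)).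

Definition RL_left (R : realType) (a beta : R) (y : R -> R) (t : R) : R :=
  (Gamma beta)^-1 * \int[leb R]_(s in `[a, t]) ((t - s) `^ (beta - 1) * y s).

Definition RL_right (R : realType) (b beta : R) (y : R -> R) (t : R) : R :=
  (Gamma beta)^-1 * \int[leb R]_(s in `[t, b]) ((s - t) `^ (beta - 1) * y s).

Definition abs_cont (R : realType) (V : normedModType R) (a b : R)
    (x : R -> V) : Prop :=
  forall e : R, 0 < e -> exists2 d : R, 0 < d &
    forall (k : nat) (l r : 'I_k -> R),
      (forall i, a <= l i /\ l i <= r i /\ r i <= b) ->
      trivIset [set: 'I_k] (fun i => `]l i, r i[%classic) ->
      \sum_(i < k) (r i - l i) < d ->
      \sum_(i < k) `|x (r i) - x (l i)| < e.

(* Fractional integrals of an L^1 function are only defined almost everywhere,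
   so their absolute continuity means having an absolutely continuous
   representative. *)
Definition has_abs_cont_repr (R : realType) (a b : R) (y : R -> R) : Prop :=
  exists2 z : R -> R, abs_cont a b z & ae_itv a b (fun t => y t = z t).

Definition frac_L1 (R : realType) (a b alpha : R) (y : R -> R) : Prop :=
  [/\ (leb R).-integrable `[a, b] (EFin \o y),
      has_abs_cont_repr a b (RL_left a alpha y) &
      has_abs_cont_repr a b (RL_right b alpha y)].

Definition frac_AC (R : realType) (n : nat) (a b : R) (alpha : 'I_n -> R)
    (x : R -> 'rV[R]_n) : Prop :=
  abs_cont a b x /\
  forall i : 'I_n,
    (exists2 g : R -> R, frac_L1 a b (alpha i) g &
       ae_itv a b (fun t => x t 0 i = x a 0 i + RL_left a (alpha i) g t)) /\
    (exists2 g : R -> R, frac_L1 a b (alpha i) g &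
       ae_itv a b (fun t => x t 0 i = x b 0 i + RL_right b (alpha i) g t)).

Definition Caputo_left (R : realType) (n : nat) (a : R) (alpha : 'I_n -> R)
    (x : R -> 'rV[R]_n) (t : R) : 'rV[R]_n :=
  \row_i RL_left a (1 - alpha i) (derive1 (fun s => x s 0 i)) t.

Definition Linfty (R : realType) (m : nat) (a b : R) (u : R -> 'rV[R]_m) :
    Prop :=
  (forall j : 'I_m, measurable_fun `[a, b] (fun t => u t 0 j)) /\
  exists C : R, ae_itv a b (fun t => `|u t| <= C).

Section Regularity.
Context (R : realType) (n : nat).

(* In finite dimension, continuity of x |-> 'D_h g x for every direction h is
   continuity of the differential. *)
Definition C1_map (V : normedModType R) (g : 'rV[R]_n -> V) : Prop :=
  (forall x, differentiable g x) /\
  (forall h, continuous (fun x => 'D_h g x)).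

(* Class C^1 on [a, b] x R^n, with one-sided time derivatives at a and b. *)
Definition C1_strip (a b : R) (phi : R -> 'rV[R]_n -> R) : Prop :=
  exists phit : R -> 'rV[R]_n -> R,
  [/\ forall t x, t \in `[a, b] ->
        (s - t)^-1 * (phi s x - phi t x) @[s --> within `[a, b] t^']
          --> phit t x,
      {within `[a, b] `*` [set: 'rV[R]_n],
        continuous (fun p => phit p.1 p.2)},
      forall t x, t \in `[a, b] -> differentiable (phi t) x &
      forall h, {within `[a, b] `*` [set: 'rV[R]_n],
        continuous (fun p => 'D_h (phi p.1) p.2)}].

(* The operator norm of the differential of g at x is at most N. *)
Definition diff_norm_le (V : normedModType R) (g : 'rV[R]_n -> V)
    (x : 'rV[R]_n) (N : R) : Prop :=
  forall h : 'rV[R]_n, `|'d g x h| <= N * `|h|.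

End Regularity.

(* Standing assumptions shared by the running cost (V = R) and the dynamics
   (V = R^n). *)
Definition standing_assumptions (R : realType) (n m : nat)
    (V : normedModType R) (a b : R) (Omega : set 'rV[R]_m)
    (F : R -> 'rV[R]_n -> 'rV[R]_m -> V) : Prop :=
  [/\ {within `[a, b] `*` [set: 'rV[R]_n * 'rV[R]_m],
        continuous (fun p => F p.1 p.2.1 p.2.2)},
      forall t u, t \in `[a, b] -> C1_map (fun x => F t x u),
      forall B : set 'rV[R]_n, compact B -> exists2 K : R, 0 < K &
        forall x y t u, B x -> B y -> t \in `[a, b] -> Omega u ->
          `|F t x u - F t y u| <= K * `|x - y|,
      exists2 N : R, 0 < N & forall t x u, t \in `[a, b] -> Omega u ->
        diff_norm_le (fun z => F t z u) x N &
      exists2 M : R, 0 < M & forall t x u, t \in `[a, b] -> Omega u ->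
        `|F t x u| <= M].

Section ControlProblem.
Context (R : realType) (n m : nat) (a b : R) (alpha : 'I_n -> R).
Context (L : R -> 'rV[R]_n -> 'rV[R]_m -> R).
Context (f : R -> 'rV[R]_n -> 'rV[R]_m -> 'rV[R]_n).
Context (phi : R -> 'rV[R]_n -> R).
Context (Omega : set 'rV[R]_m) (xa : 'rV[R]_n).

Definition objective (x : R -> 'rV[R]_n) (u : R -> 'rV[R]_m) : R :=
  phi b (x b) + \int[leb R]_(t in `[a, b]) L t (x t) (u t).

Definition state_trajectory (u : R -> 'rV[R]_m) (x : R -> 'rV[R]_n) : Prop :=
  [/\ frac_AC a b alpha x,
      ae_itv a b (fun t => Caputo_left a alpha x t = f t (x t) (u t)) &
      x a = xa].

Definition admissible (x : R -> 'rV[R]_n) (u : R -> 'rV[R]_m) : Prop :=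
  [/\ Linfty a b u, state_trajectory u x & ae_itv a b (fun t => Omega (u t))].

Definition optimal (x : R -> 'rV[R]_n) (u : R -> 'rV[R]_m) : Prop :=
  admissible x u /\
  forall y w, admissible y w -> objective y w <= objective x u.

End ControlProblem.

(* Averages are taken over the part of the ball inside [a, b], so that a can be
   a Lebesgue point; for a < tau < b this is the usual notion. *)
Definition lebesgue_pt_itv (R : realType) (V : normedModType R) (a b : R)
    (F : R -> V) (tau : R) : Prop :=
  iavg (fun s => `|F s - F tau|) (`[a, b] `&` ball tau r) @[r --> 0^'+]
    --> 0%E.

Definition needle (R : realType) (m : nat) (u : R -> 'rV[R]_m) (tau : R)
    (v : 'rV[R]_m) (theta : R) (t : R) : 'rV[R]_m :=
  if t \in `[tau, tau + theta[ then v else u t.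

(* Main.v *)
From HB Require Import structures.
Require Import Defs.
From mathcomp Require Import all_boot all_order all_algebra.
From mathcomp Require Import all_classical all_reals all_analysis.
From mathcomp Require Import measurable_realfun ring lra.
Import Order.TTheory GRing.Theory Num.Theory.
Import numFieldNormedType.Exports.
Set Implicit Arguments.
Unset Strict Implicit.
Unset Printing Implicit Defensive.
Local Open Scope classical_set_scope.
Local Open Scope ring_scope.

(** The proof turns the Caputo equation into a Volterra integral equation and
    then runs a Gronwall argument adapted to its weakly singular kernel.

    Let x be a trajectory for a control u, let p be the order of its i-th
    component and let C be the Caputo derivative of that component. Since x is
    absolutely continuous, its increments are the integrals of its pointwise
    derivative ([abs_cont_FTC]). Fubini's theorem and the fact that
    (t - s)^(p - 1) (s - r)^(-p), integrated over s in ]r, t[, does not depend on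
    r and t ([abel_convolution]) then give Abel's inversion formula, that is,
      x_i(t) - x_i(a) = kappa * int_a^t (t - s)^(p - 1) C(s) ds
    for every t in [a, b] ([Caputo_volterra]), where C = f(., x, u)_i almost
    everywhere. The constant kappa is Gamma(1 - p) divided by a Beta integral; it
    is finite and the same for all trajectories.

    Let w be the distance between the trajectories of the needle control and of
    the optimal control. Outside the needle interval the two values of C differ
    by at most K * w, with K a Lipschitz constant of f on a compact set that
    contains all trajectories; inside it they differ by at most 2 * M. With S
    the supremum of w(t) exp(-(t - a) / scale), the Volterra equation bounds
    w(t) exp(-(t - a) / scale) by the sum of two terms ([volterra_gronwall]):
    - a memory term, at most a constant times K * S * scale^p, because
      int (t - s)^(p - 1) exp(-(t - s) / scale) ds = scale^p Gamma(p);
    - a needle term of order M * theta^p, because the kernel integrated over an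
      interval of length theta is of that order.
    A small scale makes the memory term at most S / 2, whence S is at most twice
    the needle term ([needle_gap]), which tends to 0 with theta.

    For the fundamental theorem of calculus, the total variation function of an
    absolutely continuous function is absolutely continuous, so the function is
    a difference of two nondecreasing absolutely continuous ones. The
    Lebesgue-Stieltjes measure of such a function vanishes on Lebesgue null sets
    and hence has a Radon-Nikodym density, which is the derivative almost
    everywhere by Lebesgue's differentiation theorem. *)

Local Notation leb R := (@lebesgue_measure R).

(** * Integrals of almost everywhere equal functions, affine change of variables *)

Section ae_integral.
Local Open Scope ereal_scope.
Context d (T : measurableType d) (R : realType).
Variable mu : {measure set T -> \bar R}.
Import HBNNSimple.

Let ge0_ae_le_integral (f g : T -> \bar R) :
  (forall x, 0 <= f x) -> (forall x, 0 <= g x) ->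
  {ae mu, forall x, f x = g x} -> \int[mu]_x f x <= \int[mu]_x g x.
Proof.
move=> f0 g0 [N [mN N0 fgN]].
rewrite !ge0_integralTE//; apply: ge_ereal_sup => _ /= [h hf <-].
pose h' := mul_nnsfun h (indic_nnsfun R (measurableC mN)).
have -> : sintegral mu h = sintegral mu h'.
  rewrite -!integralT_nnsfun; apply: ge0_ae_eq_integral => //.
  - exact/measurable_EFinP.
  - exact/measurable_EFinP.
  - by move=> x _; rewrite lee_fin.
  - by move=> x _; rewrite lee_fin.
  exists N; split=> // x /= hx; apply: contrapT => Nx; apply: hx => _.
  by rewrite /= /mindic indicE mem_set ?mulr1.
apply: ereal_sup_ubound; exists h' => //= x.
rewrite /mindic indicE; have [Nx|Nx] := pselect (N x).
  by rewrite memNset ?mulr0.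
rewrite mem_set// mulr1; suff <- : f x = g x by [].
by apply: contrapT => fg; exact/Nx/fgN.
Qed.

(** Integrals are suprema over simple functions below the integrand, and
    cutting a simple function off on a null set does not change its integral.
    The generality matters because the pointwise derivative of an absolutely
    continuous function is only known to agree almost everywhere with a Borel
    function. *)
Lemma ae_eq_integral_any (D : set T) (f g : T -> \bar R) :
  {ae mu, forall x, D x -> f x = g x} ->
  \int[mu]_(x in D) f x = \int[mu]_(x in D) g x.
Proof.
move=> fg; rewrite integral_mkcond [RHS]integral_mkcond.
have {}fg : {ae mu, forall x, (f \_ D) x = (g \_ D) x}.
  case: fg => N [mN N0 fgN]; exists N; split=> // x /= fgx.
  apply: fgN => /= fgD; apply: fgx; rewrite !patchE; case: ifPn => //.
  by rewrite inE; exact: fgD.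
rewrite integralE [RHS]integralE.
by congr (_ - _); apply/eqP; rewrite eq_le !ge0_ae_le_integral//;
  case: fg => N [mN N0 fgN]; exists N; split=> // x /= fgx; apply: fgN => /= fgD;
  apply: fgx; rewrite ?funeposE ?funenegE fgD.
Qed.

End ae_integral.

Section affine.
Local Open Scope ereal_scope.
Context (R : realType).

(** The image of Lebesgue measure under an affine map is a multiple of Lebesgue
    measure, as both agree on half-open intervals. *)
Lemma ge0_integral_affine (c d : R) (f : R -> \bar R) : (0 < c)%R ->
  measurable_fun setT f -> (forall x, 0 <= f x) ->
  \int[leb R]_x f (c * x + d)%R = c^-1%:E * \int[leb R]_x f x.
Proof.
move=> c0 mf f0.
have c0' : (0 <= c)%R by exact: ltW.
pose phi := (fun x : R => c * x + d)%R : measurableTypeR R -> measurableTypeR R.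
have mphi : measurable_fun setT phi.
  by apply: measurable_funD => //; exact: measurable_funM.
pose pm : {measure set (measurableTypeR R) -> \bar R} :=
  measure_function_pushforward__canonical__measure_function_Measure (leb R) mphi.
pose nu : {measure set (measurableTypeR R) -> \bar R} := mscale (NngNum c0') pm.
have nuE A : measurable A -> leb R A = nu A.
  apply: lebesgue_measure_unique => _ [[u v]] _ <-.
  have pre : phi @^-1` `]u, v]%classic = `]((u - d) / c)%R, ((v - d) / c)%R]%classic.
    apply/seteqP; split => x /=; rewrite /phi !in_itv/=;
    by rewrite ltr_pdivrMr// ler_pdivlMr// ltrBlDr lerBrDr mulrC.
  have -> : nu `]u, v]%classic = c%:E * leb R (phi @^-1` `]u, v]%classic) by [].
  rewrite pre.
  rewrite !lebesgue_measure_itv/= !lte_fin ltr_pM2r ?invr_gt0// ltrD2r.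
  case: ifPn => _; last by rewrite mule0.
  by rewrite -!EFinB -EFinM; congr EFin; field; rewrite gt_eqF.
have -> : \int[leb R]_x f x = \int[nu]_x f x.
  by apply: eq_measure_integral => A mA _; exact: nuE.
rewrite ge0_integral_mscale//= muleA -EFinM mulVf ?gt_eqF// mul1e.
by rewrite ge0_integral_pushforward.
Qed.

Lemma ge0_integral_opp (f : R -> \bar R) :
  measurable_fun setT f -> (forall x, 0 <= f x) ->
  \int[leb R]_x f (- x)%R = \int[leb R]_x f x.
Proof.
move=> mf f0.
have -> : \int[leb R]_x f x = \int[pushforward (leb R) (-%R : _ -> measurableTypeR R)]_x f x.
  by apply: eq_measure_integral => A mA _; apply/esym/lebesgue_measureN.
by rewrite ge0_integral_pushforward.
Qed.

End affine.

(** * The Abel kernel and the Gamma integral *)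

Section abel_kernel.
Context (R : realType).
Local Notation mu := (leb R).
Implicit Types p r s t x e : R.

(** The kernel of fractional integration, extended by 0 so that integrals over
    moving intervals [a, t] become convolutions over the whole line. *)
Definition abel p r : R := if 0 < r then r `^ (p - 1) else 0.

Lemma abel_gt0E p r : 0 < r -> abel p r = r `^ (p - 1).
Proof. by rewrite /abel => ->. Qed.

Lemma abel_le0E p r : r <= 0 -> abel p r = 0.
Proof. by rewrite /abel leNgt => /negbTE ->. Qed.

Lemma abel_ge0 p r : 0 <= abel p r.
Proof. by rewrite /abel; case: ifP => // _; exact: powR_ge0. Qed.

Lemma measurable_abel p : measurable_fun setT (abel p).
Proof.
apply: measurable_fun_ifT => //.
- exact: measurable_fun_ltr.
Qed.

Lemma ge0_abelE p r : p != 1 -> 0 <= r -> abel p r = r `^ (p - 1).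
Proof.
move=> p1; rewrite le_eqVlt => /predU1P[<-|]; last exact: abel_gt0E.
by rewrite abel_le0E// powR0// subr_eq0.
Qed.

Let is_derive_powRV p x : 0 < p -> 0 < x ->
  is_derive x 1 (fun x : R => p^-1 * x `^ p) (x `^ (p - 1)).
Proof.
move=> p0 x0; have h := @is_derive1_powR _ p _ x0.
have := @is_deriveZ _ _ _ _ p^-1 _ _ _ h.
by move/is_derive_eq; apply; rewrite /GRing.scale/= mulKf// gt_eqF.
Qed.

(** The kernel is singular at 0, so the fundamental theorem applies only away
    from 0; monotone convergence then reaches ]0, 1]. *)
Let integral_abel_itv p e : 0 < p -> 0 < e -> e < 1 ->
  (\int[mu]_(x in `[e, 1%R]) (abel p x)%:E <= (p^-1)%:E)%E.
Proof.
move=> p0 e0 e1.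
have cvgF x : 0 < x -> {for x, continuous (fun x : R => p^-1 * x `^ p)}.
  move=> x0; apply: differentiable_continuous; apply/derivable1_diffP.
  by have [] := is_derive_powRV p0 x0.
have x0 x : x \in `[e, 1] -> 0 < x.
  by rewrite in_itv/= => /andP[+ _]; exact: lt_le_trans.
rewrite (@continuous_FTC2 _ _ (fun x => p^-1 * x `^ p))//.
- rewrite -EFinB lee_fin powR1 mulr1 lerBlDr lerDl mulr_ge0 ?powR_ge0//.
  by rewrite invr_ge0 ltW.
- apply: (@subspace_eq_continuous _ _ _ (fun x => x `^ (p - 1))).
    by move=> x; rewrite inE/= => /x0 ?; exact/esym/abel_gt0E.
  apply: continuous_in_subspaceT => x; rewrite inE/= => /x0 {}x0.
  apply: differentiable_continuous; apply/derivable1_diffP.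
  by have [] := @is_derive1_powR _ (p - 1) _ x0.
- split.
  + move=> x; rewrite in_itv/= => /andP[ex _].
    by have [] := is_derive_powRV p0 (lt_trans e0 ex).
  + by apply: cvg_at_right_filter; apply: cvgF.
  + by apply: cvg_at_left_filter; apply: cvgF.
- move=> x; rewrite in_itv/= => /andP[ex _].
  have {}x0 : 0 < x by exact: lt_trans ex.
  rewrite derive1E abel_gt0E//.
  by have [_ ->] := is_derive_powRV p0 x0.
Qed.

Let integral_abel01 p : 0 < p ->
  (\int[mu]_(x in `]0%R, 1%R]) (abel p x)%:E <= (p^-1)%:E)%E.
Proof.
move=> p0; pose F n := `[(n.+2%:R : R)^-1, 1]%classic.
have -> : `]0, 1]%classic = \bigcup_n F n.
  apply/seteqP; split => [x|x [n _]]; rewrite /F/= !in_itv/=.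
    move=> /andP[x0 x1]; exists (Num.truncn x^-1) => //=.
    rewrite /F/= in_itv/= x1 andbT -[leRHS]invrK lef_pV2 ?posrE ?invr_gt0//.
    apply: le_trans (ltW (truncnS_gt _)) _.
    by rewrite ler_nat.
  move=> /andP[nx ->]; rewrite andbT; apply: lt_le_trans nx.
  by rewrite invr_gt0.
have mF i : measurable (F i) by exact: measurable_itv.
have mf i : measurable_fun (F i) (EFin \o abel p).
  by apply/measurable_EFinP; apply: measurable_funTS; exact: measurable_abel.
have ndF : nondecreasing_seq F.
  move=> n m nm; apply/subsetPset => x; rewrite /F/= !in_itv/= => /andP[nx ->].
  rewrite andbT; apply: le_trans nx.
  by rewrite lef_pV2 ?posrE// ler_nat !ltnS.
have f0 i x : F i x -> (0 <= (EFin \o abel p) x)%E by rewrite lee_fin abel_ge0.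
have cvg := ge0_nondecreasing_set_cvg_integral (mu := mu) ndF mF mf f0.
rewrite -(cvg_lim _ cvg)//; apply: lime_le; first by apply/cvg_ex; eexists; exact: cvg.
apply: nearW => n; apply: integral_abel_itv => //.
by rewrite invf_lt1// ltr1n.
Qed.

Definition gamma_density p r : R := abel p r * expR (- r).

Lemma gamma_density_ge0 p r : 0 <= gamma_density p r.
Proof. by rewrite mulr_ge0 ?abel_ge0 ?expR_ge0. Qed.

Lemma measurable_gamma_density p : measurable_fun setT (gamma_density p).
Proof.
apply: measurable_funM; first exact: measurable_abel.
by apply: measurableT_comp => //; exact: measurable_funN.
Qed.

(** The integrand is below the kernel on ]0, 1] and below exp(-x) beyond 1. *)
Lemma integral_gamma_density_lty p : 0 < p -> p <= 1 ->
  (\int[mu]_x (gamma_density p x)%:E < +oo)%E.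
Proof.
move=> p0 p1.
pose g x := (((abel p \_ `]0, 1]%classic) x)%:E + (exponential_pdf 1 x)%:E)%E.
have mabel : measurable_fun setT (abel p \_ `]0, 1]%classic).
  by apply/measurable_restrict => //; apply: measurable_funTS; exact: measurable_abel.
apply: (@le_lt_trans _ _ (\int[mu]_x g x)%E).
  apply: ge0_le_integral => //.
  - by move=> x _; rewrite lee_fin gamma_density_ge0.
  - apply/measurable_EFinP; exact: measurable_gamma_density.
  - by apply/measurable_EFinP; apply: measurable_funD => //; exact: measurable_exponential_pdf.
  move=> x _.  rewrite /g -EFinD lee_fin /gamma_density patchE. 
  have [x0|x0] := leP x 0.
    by rewrite abel_le0E// mul0r addr_ge0 ?exponential_pdf_ge0//; case: ifP.
  rewrite (exponential_pdfE _ (ltW x0)) mul1r mulN1r.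
  have [x1|x1] := leP x 1.
    rewrite mem_set/= ?in_itv/= ?x0 ?x1//.  apply: ler_wpDr; first exact: expR_ge0.
    by rewrite ler_piMr ?abel_ge0// -expR0 ler_expR oppr_le0 ltW.
  rewrite memNset/= ?in_itv/= ?x0/=; last by rewrite leNgt x1.
  rewrite add0r ler_piMl ?expR_ge0// abel_gt0E//.
  by rewrite -[leRHS](powRr0 x) ler_powR ?(ltW x1)// subr_le0.
rewrite ge0_integralD//=; last 4 first.
- by move=> x _; rewrite lee_fin patchE; case: ifP => // _; exact: abel_ge0.
- exact/measurable_EFinP.
- by move=> x _; rewrite lee_fin exponential_pdf_ge0.
- by apply/measurable_EFinP; exact: measurable_exponential_pdf.
rewrite integral_exponential_pdf// lte_add_pinfty ?ltry//.
rewrite [X in (X < _)%E](_ : _ = \int[mu]_(x in `]0%R, 1%R]) (abel p x)%:E)%E; last first.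
  by rewrite [RHS]integral_mkcond; apply: eq_integral => x _; rewrite !patchE; case: ifP.
by apply: le_lt_trans (integral_abel01 p0) _; rewrite ltry.
Qed.

End abel_kernel.

(** * Convolution and Laplace integrals of Abel kernels *)

Section beta.
Context (R : realType).
Local Notation mu := (leb R).
Implicit Types p q r s t x c : R.

Lemma ge0_integral_reflect c (f : R -> \bar R) :
  measurable_fun setT f -> (forall x, 0 <= f x)%E ->
  (\int[mu]_x f (c - x)%R = \int[mu]_x f x)%E.
Proof.
move=> mf f0; pose h x := f (1 * x + c)%R.
have mh : measurable_fun setT h.
  by apply: measurableT_comp => //; apply: measurable_funD => //; exact: measurable_funM.
transitivity (\int[mu]_x h (- x)%R)%E.
  by apply: eq_integral => x _; rewrite /h mul1r addrC.
rewrite ge0_integral_opp//; last by move=> x; exact: f0.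
by rewrite /h ge0_integral_affine// invr1 mul1e.
Qed.

Lemma abelM p c r : 0 < c -> abel p (c * r) = c `^ (p - 1) * abel p r.
Proof.
move=> c0; have [r0|r0] := leP r 0.
  by rewrite !abel_le0E ?mulr0// pmulr_rle0.
by rewrite !abel_gt0E ?mulr_gt0// powRM ?ltW.
Qed.

Lemma abel_nincr p r s : p <= 1 -> 0 < r -> r <= s -> abel p s <= abel p r.
Proof.
move=> p1 r0 rs; have s0 := lt_le_trans r0 rs.
rewrite !abel_gt0E// -(opprK (p - 1)) (powRN r) (powRN s) lef_pV2 ?posrE ?powR_gt0//.
by rewrite ge0_ler_powR ?nnegrE ?(ltW r0) ?(ltW s0)// opprB subr_ge0.
Qed.

Lemma abel_ge1 p r : p <= 1 -> 0 < r -> r <= 1 -> 1 <= abel p r.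
Proof.
move=> p1 r0 r1; apply: le_trans (abel_nincr p1 r0 r1).
by rewrite abel_gt0E// powR1.
Qed.

(** Reduces the integrability of the kernel on ]0, 1] to the finiteness of the
    Gamma integral. *)
Lemma abel_le_gamma_density p r : r <= 1 ->
  abel p r <= expR 1 * gamma_density p r.
Proof.
move=> r1; rewrite /gamma_density mulrCA -expRD ler_peMr ?abel_ge0//.
by rewrite -[leLHS]expR0 ler_expR subr_ge0.
Qed.

Definition beta p q : \bar R := (\int[mu]_x (abel p (1 - x) * abel q x)%:E)%E.

Let measurable_beta_integrand p q r t :
  measurable_fun setT (fun s => abel p (t - s) * abel q (s - r)).
Proof.
by apply: measurable_funM; (apply: measurableT_comp; first exact: measurable_abel);
  apply: measurable_funB.
Qed.

(** Lower bounds for the Beta and Gamma integrals come from ]0, 1[ alone. *)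
Let le_integral_unit_itv (f : R -> R) e : (forall x, 0 <= f x) -> measurable_fun setT f ->
  0 <= e -> (forall x, 0 < x -> x < 1 -> e <= f x) -> (e%:E <= \int[mu]_x (f x)%:E)%E.
Proof.
move=> f0 mf e0 f1.
have -> : e%:E = (\int[mu]_(x in `]0%R, 1%R[) e%:E)%E.
  rewrite integral_cst//= lebesgue_measure_itv/= lte_fin ltr01.
  by rewrite oppr0 adde0 mule1.
apply: (@le_trans _ _ (\int[mu]_(x in `]0%R, 1%R[) (f x)%:E)%E).
  apply: ge0_le_integral => //.
  - by apply/measurable_EFinP; exact: measurable_funTS.
  - by move=> x; rewrite /= in_itv/= => /andP[x0 x1]; rewrite lee_fin f1.
apply: ge0_subset_integral => //.
- exact/measurable_EFinP.
- by move=> x _; rewrite lee_fin.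
Qed.

Lemma beta_ge1 p q : p <= 1 -> q <= 1 -> (1 <= beta p q)%E.
Proof.
move=> p1 q1; apply: le_integral_unit_itv => //.
- by move=> x; rewrite mulr_ge0 ?abel_ge0.
- have := measurable_beta_integrand p q 0 1.
  by under eq_fun do rewrite subr0.
move=> x x0 x1; rewrite -[leLHS]mul1r ler_pM ?abel_ge1//.
- by rewrite subr_gt0.
- by rewrite lerBlDr lerDl ltW.
- exact: ltW.
Qed.

(** The two singularities, at 0 and at 1, are separated by 1/2: on either side
    one factor is bounded by its value at 1/2. *)
Lemma beta_lty p q : 0 < p <= 1 -> 0 < q <= 1 -> (beta p q < +oo)%E.
Proof.
move=> /andP[p0 p1] /andP[q0 q1].
(* Kernel values at 1/2 bound the regular factor; expR 1 is the cost of passing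
   from the kernel to the Gamma density on ]0, 1]. *)
pose C := (abel p 2^-1 + abel q 2^-1) * expR 1.
have C0 : 0 <= C by rewrite mulr_ge0 ?addr_ge0 ?abel_ge0 ?expR_ge0.
have mgd : measurable_fun setT (fun x => (gamma_density p (1 - x))%:E).
  apply/measurable_EFinP; apply: measurableT_comp; first exact: measurable_gamma_density.
  exact: measurable_funB.
have mgd' : measurable_fun setT (fun x => (gamma_density q x)%:E).
  by apply/measurable_EFinP; exact: measurable_gamma_density.
apply: (@le_lt_trans _ _ (\int[mu]_x
  (C%:E * ((gamma_density p (1 - x))%:E + (gamma_density q x)%:E)))%E).
  apply: ge0_le_integral => //.
  - by move=> x _; rewrite lee_fin mulr_ge0 ?abel_ge0.
  - apply/measurable_EFinP; have := measurable_beta_integrand p q 0 1.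
    by under eq_fun do rewrite subr0.
  - by apply: measurable_funeM; exact: emeasurable_funD.
  move=> x _; rewrite -EFinD -EFinM lee_fin.
  have [x0|x0] := leP x 0.
    by rewrite (abel_le0E q x0) mulr0 mulr_ge0 ?addr_ge0 ?gamma_density_ge0.
  have [x1|x1] := leP 1 x.
    by rewrite (@abel_le0E _ p (1 - x)) ?subr_le0// mul0r mulr_ge0 ?addr_ge0 ?gamma_density_ge0.
  rewrite /C -mulrA mulrDl.
  have [P0 Q0] : 0 <= abel p 2^-1 /\ 0 <= abel q 2^-1 by rewrite !abel_ge0.
  have hp : abel p (1 - x) <= expR 1 * gamma_density p (1 - x).
    by apply: abel_le_gamma_density; rewrite lerBlDr lerDl ltW.
  have hq : abel q x <= expR 1 * gamma_density q x.
    by apply: abel_le_gamma_density; rewrite ltW.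
  have gp := gamma_density_ge0 p (1 - x). have gq := gamma_density_ge0 q x.
  have e0 := expR_ge0 (1 : R).
  have [x2|x2] := leP x 2^-1.
    apply: (@le_trans _ _ (abel p 2^-1 * (expR 1 * gamma_density q x))).
      apply: ler_pM; rewrite ?abel_ge0//; apply: abel_nincr => //.
      by rewrite lerBrDr; lra.
    apply: ler_wpDr; first by rewrite !mulr_ge0// addr_ge0.
    by rewrite ler_wpM2l// ler_wpM2l// lerDr.
  apply: (@le_trans _ _ (abel q 2^-1 * (expR 1 * gamma_density p (1 - x)))).
    rewrite mulrC. apply: ler_pM; rewrite ?abel_ge0//; apply: abel_nincr => //.
    exact: ltW.
  apply: ler_wpDl; first by rewrite !mulr_ge0// addr_ge0.
  by rewrite ler_wpM2l// ler_wpM2l// lerDl.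
rewrite ge0_integralZl//=; last 2 first.
- exact: emeasurable_funD.
- by move=> x _; rewrite -EFinD lee_fin addr_ge0 ?gamma_density_ge0.
rewrite ge0_integralD//=; last 2 first.
- by move=> x _; rewrite lee_fin gamma_density_ge0.
- by move=> x _; rewrite lee_fin gamma_density_ge0.
rewrite (@ge0_integral_reflect 1 (fun x => (gamma_density p x)%:E)); last 2 first.
- by apply/measurable_EFinP; exact: measurable_gamma_density.
- by move=> x; rewrite lee_fin gamma_density_ge0.
apply: lte_mul_pinfty => //.
by apply: lte_add_pinfty; exact: integral_gamma_density_lty.
Qed.

(** The substitution s = (t - r) x + r produces (t - r)^(p + q - 2) from the
    kernels and (t - r) from ds. These cancel exactly when p + q = 1, which is
    why the result does not depend on r and t. *)
Lemma abel_convolution p q r t : p + q = 1 ->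
  (\int[mu]_s (abel p (t - s) * abel q (s - r))%:E = if (r < t)%R then beta p q else 0)%E.
Proof.
move=> pq; have [rt|tr] := ltP r t; last first.
  rewrite integral0_eq// => s _.
  have [st|ts] := leP t s; first by rewrite abel_le0E ?mul0r// subr_le0.
  by rewrite (@abel_le0E _ q) ?mulr0// subr_le0 (le_trans (ltW ts)).
have c0 : 0 < t - r by rewrite subr_gt0.
pose f s := (abel p (t - s) * abel q (s - r))%:E.
have mf : measurable_fun setT f.
  by apply/measurable_EFinP; exact: measurable_beta_integrand.
have f0 s : (0 <= f s)%E by rewrite lee_fin mulr_ge0 ?abel_ge0.
have := ge0_integral_affine r c0 mf f0.
have -> : (\int[mu]_x f ((t - r) * x + r)%R = ((t - r)^-1)%:E * beta p q)%E.
  rewrite /beta -ge0_integralZl//=; last 3 first.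
  - apply/measurable_EFinP; have := measurable_beta_integrand p q 0 1.
    by under eq_fun do rewrite subr0.
  - by move=> x _; rewrite lee_fin mulr_ge0 ?abel_ge0.
  - by rewrite lee_fin invr_ge0 ltW.
  apply: eq_integral => x _; rewrite /f -EFinM; congr EFin.
  rewrite addrK opprD addrCA addrA.
  rewrite (_ : - ((t - r) * x) + t - r = (t - r) * (1 - x)); last by ring.
  rewrite !abelM// mulrACA -powRD; last by rewrite (gt_eqF c0) implybT.
  by rewrite addrACA pq -opprD opprD addrA subrr sub0r powR_inv1// ltW.
have cV : ((t - r)%:E * ((t - r)^-1)%:E = 1)%E by rewrite -EFinM mulfV// gt_eqF.
move: (\int[mu]_s f s)%E (beta p q) => I B.
by move/(congr1 (fun z => (t - r)%:E * z)%E); rewrite !muleA cV !mul1e.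
Qed.

Lemma Gamma_fin p : 0 < p <= 1 ->
  (\int[mu]_x (gamma_density p x)%:E = (Gamma p)%:E)%E.
Proof.
move=> /andP[p0 p1].
have E : (\int[mu]_x (gamma_density p x)%:E =
    \int[mu]_(s in `]0%R, +oo[) (s `^ (p - 1) * expR (- s))%:E)%E.
  rewrite [RHS]integral_mkcond; apply: eq_integral => x _; rewrite patchE.
  rewrite /gamma_density; case: ifPn => x0.
    by rewrite abel_gt0E//; move: x0; rewrite inE/= in_itv/= andbT.
  rewrite abel_le0E ?mul0r// leNgt; apply: contra x0.
  by rewrite inE/= in_itv/= andbT.
rewrite /Gamma /Rintegral -E fineK// ge0_fin_numE ?integral_gamma_density_lty//.
by apply: integral_ge0 => x _; rewrite lee_fin gamma_density_ge0.
Qed.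

Lemma Gamma_gt0 p : 0 < p <= 1 -> 0 < Gamma p.
Proof.
move=> p01; rewrite -lte_fin -Gamma_fin//; case/andP: p01 => p0 p1.
apply: (@lt_le_trans _ _ (expR (-1))%:E); first by rewrite lte_fin expR_gt0.
apply: le_integral_unit_itv.
- exact: gamma_density_ge0.
- exact: measurable_gamma_density.
- exact: expR_ge0.
move=> x x0 x1; rewrite -[leLHS]mul1r ler_pM ?expR_ge0 ?abel_ge1//; first exact: ltW.
by rewrite ler_expR lerN2 ltW.
Qed.

(** The substitution x = l (t - s) in the Gamma integral. *)
Lemma laplace_abel p l t : 0 < p <= 1 -> 0 < l ->
  (\int[mu]_s (abel p (t - s) * expR (- (l * (t - s))))%:E = (l `^ (- p) * Gamma p)%:E)%E.
Proof.
move=> p01 l0.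
have mlap : measurable_fun setT (fun x => (abel p x * expR (- (l * x)))%:E).
  apply/measurable_EFinP; apply: measurable_funM; first exact: measurable_abel.
  by apply: measurableT_comp => //; apply: measurableT_comp => //; exact: measurable_funM.
have lap0 x : (0 <= (abel p x * expR (- (l * x)))%:E)%E.
  by rewrite lee_fin mulr_ge0 ?abel_ge0 ?expR_ge0.
rewrite (@ge0_integral_reflect t (fun x => (abel p x * expR (- (l * x)))%:E))//.
have mgd : measurable_fun setT (fun x => (gamma_density p x)%:E).
  by apply/measurable_EFinP; exact: measurable_gamma_density.
have gd0 x : (0 <= (gamma_density p x)%:E)%E by rewrite lee_fin gamma_density_ge0.
have := @ge0_integral_affine R l 0 (fun x => (gamma_density p x)%:E) l0 mgd gd0.
rewrite Gamma_fin//.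
under eq_integral do rewrite addr0 /gamma_density abelM// -mulrA EFinM.
rewrite ge0_integralZl//=; last by rewrite lee_fin powR_ge0.
move/(congr1 (fun z => (l `^ (1 - p))%:E * z)%E).
rewrite !muleA -!EFinM -!powRD; try by rewrite (gt_eqF l0) implybT.
rewrite addrA subrK subrr powRr0 mul1e => ->; congr EFin; congr (_ * _).
rewrite -[l^-1]powR_inv1 ?(ltW l0)// -powRD; last by rewrite (gt_eqF l0) implybT.
by congr (_ `^ _); ring.
Qed.

End beta.

(** * Absolute continuity on lists of intervals and total variation *)

Section nonoverlapping.
Context (R : realType).
Implicit Types (s : seq (R * R)) (p q : R * R) (f g : R -> R).

(** Lists sorted from left to right, possibly with shared endpoints: this form
    of a family of disjoint open intervals can be refined and concatenated by
    induction. *)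
Definition nonoverlapping s : bool :=
  all (fun p => p.1 <= p.2) s && pairwise (fun p q => p.2 <= q.1) s.

Definition subitvs (a b : R) s : bool := all (fun p => (a <= p.1) && (p.2 <= b)) s.

Definition total_length s : R := \sum_(p <- s) (p.2 - p.1).

Definition seq_abs_cont (a b : R) f : Prop :=
  forall e : R, 0 < e -> exists2 d : R, 0 < d &
    forall s, nonoverlapping s -> subitvs a b s -> total_length s < d ->
      \sum_(p <- s) `|f p.2 - f p.1| < e.

Lemma nonoverlapping_cat s1 s2 (c : R) :
  nonoverlapping s1 -> nonoverlapping s2 ->
  all (fun p => p.2 <= c) s1 -> all (fun p => c <= p.1) s2 ->
  nonoverlapping (s1 ++ s2).
Proof.
move=> /andP[l1 p1] /andP[l2 p2] /allP s1c /allP s2c.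
rewrite /nonoverlapping all_cat l1 l2/= pairwise_cat p1 p2 !andbT.
by apply/allrelP => p q /s1c pc /s2c; exact: le_trans.
Qed.

Lemma abs_cont_seq a b f : abs_cont a b f -> seq_abs_cont a b f.
Proof.
move=> fab e /fab[d d0 H]; exists d => // s /andP[/allP sle spw] /allP sab sd.
pose l (i : 'I_(size s)) := (nth (0, 0) s i).1.
pose r (i : 'I_(size s)) := (nth (0, 0) s i).2.
have lr i : l i <= r i by apply: sle; exact: mem_nth.
have := H (size s) l r.
rewrite /total_length (big_nth (0, 0)) big_mkord in sd.
rewrite (big_nth (0, 0)) big_mkord; apply => //.
- by move=> i; have := sab _ (mem_nth (0, 0) (ltn_ord i)) => /andP[].
- move=> i j _ _ [x []]; rewrite /= !in_itv/= => /andP[lx xr] /andP[lx' xr'].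
  have pw := pairwiseP (0, 0) spw.
  apply/val_inj; case: (ltngtP i j) => // ij.
  + have := pw _ _ (ltn_ord i) (ltn_ord j) ij; rewrite -/(r i) -/(l j) leNgt.
    by rewrite (lt_trans lx' xr).
  + have := pw _ _ (ltn_ord j) (ltn_ord i) ij; rewrite -/(r j) -/(l i) leNgt.
    by rewrite (lt_trans lx xr').
Qed.

Fixpoint consecutive (a : R) (t : seq R) : seq (R * R) :=
  if t is x :: t' then (a, x) :: consecutive x t' else [::].

(** Links variations along partitions to sums over nonoverlapping lists. *)
Lemma consecutive_partition a b t : itv_partition a b t ->
  [/\ nonoverlapping (consecutive a t), subitvs a b (consecutive a t),
      total_length (consecutive a t) = b - a &
      forall f, variation a b f t = \sum_(p <- consecutive a t) `|f p.2 - f p.1|].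
Proof.
elim: t a => [|x t ih] a abt.
  have -> := itv_partition_nil abt.
  rewrite /total_length/= big_nil subrr; split => // f.
  by rewrite variation_nil big_nil.
have [no sub len var] := ih _ (itv_partition_cons abt).
have xb := itv_partition_le (itv_partition_cons abt).
have ax : a < x by move: abt => [/= /andP[]].
split => /=.
- rewrite -cat1s; apply: (@nonoverlapping_cat _ _ x) => //=.
  + by rewrite /nonoverlapping/= (ltW ax).
  + by rewrite lexx.
  + by apply: sub_all sub => p /andP[].
- rewrite lexx xb/=; apply: sub_all sub => p /andP[xp ->].
  by rewrite andbT (le_trans _ xp)// ltW.
- by rewrite /total_length big_cons/= -/(total_length _) len addrC addrA subrK.
- move=> f; rewrite big_cons -var/= /variation/= big_nat_recl//=.
Qed.

Lemma seq_abs_contB a b f g : seq_abs_cont a b f -> seq_abs_cont a b g ->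
  seq_abs_cont a b (f \- g).
Proof.
move=> fab gab e e0; have e20 : 0 < e / 2 by rewrite divr_gt0.
have [d d0 fd] := fab _ e20; have [d' d'0 gd] := gab _ e20.
exists (Num.min d d'); first by rewrite lt_min d0.
move=> s no sub; rewrite lt_min => /andP[sd sd'].
rewrite (splitr e); apply: le_lt_trans (ltrD (fd _ no sub sd) (gd _ no sub sd')).
rewrite -big_split/=; apply: ler_sum => p _.
rewrite [X in `|X|](_ : _ = (f p.2 - f p.1) - (g p.2 - g p.1)); last by ring.
exact: ler_normB.
Qed.

Section variation_function.
Variables (a b : R) (f : R -> R).
Hypothesis ab : a <= b.
Hypothesis fab : seq_abs_cont a b f.

Let bounded_variation_small : exists2 d : R, 0 < d &
  forall u w, a <= u -> u <= w -> w <= b -> w - u < d -> bounded_variation u w f.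
Proof.
have [d d0 fd] := fab ltr01; exists d => // u w au uw wb wud.
exists 1 => _ [t uwt <-].
have [no sub len ->] := consecutive_partition uwt.
apply/ltW/fd => //; last by rewrite len.
by apply: sub_all sub => p /andP[up pw]; rewrite (le_trans au up) (le_trans pw wb).
Qed.

(** Intervals shorter than the modulus for 1 have variation at most 1, and
    finitely many of them cover [a, b]. *)
Lemma seq_abs_cont_bounded_variation : bounded_variation a b f.
Proof.
have [d d0 fd] := bounded_variation_small.
pose N := (Num.truncn ((b - a) / d)).+1.
have N0 : 0 < N%:R :> R by rewrite ltr0n.
(* N is chosen so that the step h is below the modulus d. *)
pose h := (b - a) / N%:R.
have h0 : 0 <= h by rewrite divr_ge0 ?subr_ge0// ltW.
have hd : h < d by rewrite /h ltr_pdivrMr// mulrC -ltr_pdivrMr// truncnS_gt.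
suff H k : (k <= N)%N -> bounded_variation a (a + k%:R * h) f.
  by have := H N (leqnn N); rewrite /h mulrC divfK ?gt_eqF// addrC subrK.
elim: k => [_|k ih kN]; first by rewrite mul0r addr0; exact: bounded_variationxx.
have kh0 : 0 <= k%:R * h by rewrite mulr_ge0.
have kSh : a + k.+1%:R * h <= b.
  rewrite -lerBrDl /h mulrC -mulrAC ler_pdivrMr// ler_wpM2l ?subr_ge0//.
  by rewrite ler_nat.
have le1 : a <= a + k%:R * h by rewrite lerDl.
have le2 : a + k%:R * h <= a + k.+1%:R * h by rewrite lerD2l ler_wpM2r// ler_nat.
apply/bounded_variationP; first exact: le_trans le2.
rewrite (total_variationD f le1 le2) fin_numD; apply/andP; split.
  by apply/bounded_variationP => //; apply: ih; exact: ltnW.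
apply/bounded_variationP => //; apply: fd => //.
by rewrite opprD addrACA subrr add0r -mulrBl -natrB// subSnn mul1r.
Qed.

Let v t := fine (total_variation a t f).

Let vE u w : a <= u -> u <= w -> w <= b ->
  (total_variation u w f = (v w - v u)%:E)%E.
Proof.
move=> au uw wb; have bv := seq_abs_cont_bounded_variation.
have fw : total_variation a w f \is a fin_num.
  apply/bounded_variationP; first exact: le_trans uw.
  by apply: bounded_variationl wb bv; exact: le_trans uw.
have := fw; rewrite (total_variationD f au uw) fin_numD => /andP[fu fuw].
rewrite /v (total_variationD f au uw) fineD// addrAC subrr add0r.
by rewrite fineK.
Qed.

Lemma fine_total_variation_nondecreasing u w :
  a <= u -> u <= w -> w <= b -> v u <= v w.
Proof.
move=> au uw wb; rewrite -subr_ge0 -lee_fin -vE//; exact: total_variation_ge0.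
Qed.

Lemma le_fine_total_variation u w :
  a <= u -> u <= w -> w <= b -> `|f w - f u| <= v w - v u.
Proof. by move=> au uw wb; rewrite -lee_fin -vE// total_variation_ge. Qed.

Let refine u w (e : R) : a <= u -> u <= w -> w <= b -> 0 < e ->
  exists t, [/\ nonoverlapping t, subitvs u w t, total_length t = w - u &
    v w - v u <= \sum_(p <- t) `|f p.2 - f p.1| + e].
Proof.
move=> au uw wb e0; have [uw'|uw'] := eqVneq u w.
  exists [::]; split => //; rewrite /total_length ?big_nil uw' ?subrr//.
  by rewrite add0r ltW.
have fin : total_variation u w f \is a fin_num by rewrite vE.
have [_ [_ [t uwt <-] <-]] := ub_ereal_sup_adherent e0 fin.
rewrite -/(total_variation u w f) vE// -EFinB lte_fin => H.
have [no sub len var] := consecutive_partition uwt.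
by exists (consecutive u t); split => //; rewrite -var -lerBlDr ltW.
Qed.

(** Each interval is replaced by a partition nearly realizing its variation. The
    tolerance is halved at each step so that the errors add up to at most e. *)
Let refine_seq s : nonoverlapping s -> subitvs a b s -> forall e, 0 < e ->
  exists t, [/\ nonoverlapping t,
    forall c d, subitvs c d s -> subitvs c d t,
    total_length t = total_length s &
    \sum_(p <- s) (v p.2 - v p.1) <= \sum_(p <- t) `|f p.2 - f p.1| + e].
Proof.
elim: s => [_ _ e e0|p s ih]; first by exists [::]; rewrite !big_nil add0r ltW.
move=> /andP[/= /andP[p12 s12] /andP[ps pws]] /andP[/andP[ap pb] sab] e e0.
have e20 : 0 < e / 2 by rewrite divr_gt0.
have nos : nonoverlapping s by rewrite /nonoverlapping s12.
have [t [no sub len var]] := ih nos sab _ e20.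
have [r [rno rsub rlen rvar]] := refine ap p12 pb e20.
exists (r ++ t); split.
- apply: (@nonoverlapping_cat _ _ p.2) => //.
    by apply: sub_all rsub => q /andP[].
  have : subitvs p.2 b t.
    apply: sub; apply/allP => q qs; rewrite (allP ps)//.
    by have := allP sab _ qs => /andP[].
  by apply: sub_all => q /andP[].
- move=> c d /andP[/andP[cp pd] scd]; rewrite /subitvs all_cat; apply/andP; split.
    apply: sub_all rsub => q /andP[pq qp].
    by rewrite (le_trans cp pq) (le_trans qp pd).
  exact: sub.
- by rewrite /total_length big_cat big_cons/= -/(total_length r) rlen -/(total_length t) len.
rewrite big_cons big_cat/= (splitr e) addrACA.
exact: lerD.
Qed.

(** Refining the intervals preserves their total length while it turns
    increments of the variation function into increments of f, so f and its
    variation function have essentially the same modulus. *)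
Lemma seq_abs_cont_fine_total_variation : seq_abs_cont a b v.
Proof.
move=> e e0; have e20 : 0 < e / 2 by rewrite divr_gt0.
have [d d0 fd] := fab e20; exists d => // s no sub sd.
have [t [tno tsub tlen tvar]] := refine_seq no sub e20.
rewrite (splitr e); apply: le_lt_trans (_ : \sum_(p <- t) `|f p.2 - f p.1| + e / 2 < _).
  apply: le_trans tvar; rewrite big_seq [leRHS]big_seq; apply: ler_sum => p ps.
  have /andP[ap pb] := allP sub _ ps.
  have /andP[/allP s12 _] := no.
  by rewrite ger0_norm// subr_ge0 fine_total_variation_nondecreasing// s12.
by rewrite ltrD2r fd ?tlen//; exact: tsub.
Qed.

End variation_function.

End nonoverlapping.

(** * Densities of Lebesgue-Stieltjes measures *)

Section stieltjes.
Context (R : realType).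
Implicit Types (s : seq (R * R)) (p q : R * R).

Definition cover_of s : set R := \big[setU/set0]_(p <- s) `]p.1, p.2]%classic.

Lemma measurable_cover_of s : measurable (cover_of s).
Proof. by apply: bigsetU_measurable => p _; exact: measurable_itv. Qed.

Lemma mem_cover_of s x : cover_of s x <-> exists2 p, p \in s & p.1 < x <= p.2.
Proof.
rewrite /cover_of -bigcup_seq; split => [[p /= ps]|[p ps px]].
  by rewrite in_itv/=; exists p.
by exists p => //=; rewrite in_itv/=.
Qed.

Lemma stieltjes_itvoc (G : cumulative R R) (u w : R) : u <= w ->
  (lebesgue_stieltjes_measure G `]u, w]%classic = (G w - G u)%:E)%E.
Proof.
move=> uw; rewrite /lebesgue_stieltjes_measure/= /measure_extension/=.
rewrite measurable_mu_extE//; last exact: is_ocitv.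
exact: wlength_itv_bnd.
Qed.

Lemma stieltjes_cover_of (G : cumulative R R) s : nonoverlapping s ->
  (lebesgue_stieltjes_measure G (cover_of s) = (\sum_(p <- s) (G p.2 - G p.1))%:E)%E.
Proof.
elim: s => [_|p s ih /andP[/= /andP[p12 s12] /andP[ps pws]]].
  by rewrite /cover_of !big_nil measure0.
have nos : nonoverlapping s by rewrite /nonoverlapping s12.
rewrite /cover_of !big_cons -/(cover_of s) measureU//.
- by rewrite [X in (X + _)%E]stieltjes_itvoc// [X in (_ + X)%E]ih// EFinD.
- exact: measurable_cover_of.
- rewrite -subset0 => x [/=]; rewrite in_itv/= => /andP[_ xp].
  move=> /mem_cover_of[q qs /andP[qx _]].
  by have := allP ps _ qs; rewrite leNgt (lt_le_trans qx).
Qed.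

Section dominated.
Variables (a b : R) (g : R -> R).
Hypothesis ab : a < b.
Hypothesis nd : forall u w, a <= u -> u <= w -> w <= b -> g u <= g w.
Hypothesis ac : seq_abs_cont a b g.

(** Stieltjes measures are defined from functions on the whole line; outside
    [a, b] the function is frozen at its boundary values. *)
Let clamp x := Num.max a (Num.min x b).

Let clamp_ge x : a <= clamp x. Proof. by rewrite le_max lexx. Qed.
Let clamp_le x : clamp x <= b.
Proof. by rewrite ge_max (ltW ab) ge_min lexx orbT. Qed.
Let clamp_nd x y : x <= y -> clamp x <= clamp y.
Proof.
move=> xy; rewrite /clamp ge_max !le_max lexx/= le_min.
by rewrite [Num.min x b <= b]ge_min lexx orbT [_ <= y]ge_min xy/= orbT.
Qed.
Let clamp_lip x y : x <= y -> clamp y - clamp x <= y - x.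
Proof. by move=> xy; rewrite /clamp /Num.max /Num.min; do ! case: ifPn; lra. Qed.
Let clamp_id x : a <= x -> x <= b -> clamp x = x.
Proof. by move=> ax xb; rewrite /clamp min_l// max_r. Qed.

Let G := g \o clamp.

Let G_nd : {homo G : x y / x <= y}.
Proof. by move=> x y xy; apply: nd => //; exact: clamp_nd. Qed.

Let G_rc : right_continuous G.
Proof.
move=> x; apply/cvgrPdist_lt => e e0.
have [d d0 H] := ac e0.
near=> y.
have xy : x <= y by near: y; exact: nbhs_right_ge.
have yd : y - x < d.
  by rewrite ltrBlDl; near: y; apply: nbhs_right_lt; rewrite ltrDl.
have := H [:: (clamp x, clamp y)]; rewrite /nonoverlapping /subitvs /total_length/=.
rewrite !big_seq1/= distrC; apply.
- by rewrite clamp_nd.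
- by rewrite clamp_ge clamp_le.
- exact: le_lt_trans (clamp_lip xy) yd.
Unshelve. all: by end_near. Qed.

HB.instance Definition _ := isCumulative.Build _ _ _ G G_nd G_rc.

Let GE x : a <= x -> x <= b -> (G : cumulative R R) x = g x.
Proof. by move=> ax xb; rewrite -[LHS]/(g (clamp x)) clamp_id. Qed.

Let mu := lebesgue_stieltjes_measure (G : cumulative R R).

Let h n : R := (b - a) / n.+1%:R.
Let node n j : R := a + j%:R * h n.

Let h_gt0 n : 0 < h n. Proof. by rewrite divr_gt0// subr_gt0. Qed.

Let nodeS n j : node n j.+1 = node n j + h n.
Proof. by rewrite /node -natr1 mulrDl mul1r addrA. Qed.

Let node_nd n j k : (j <= k)%N -> node n j <= node n k.
Proof. by move=> jk; rewrite /node lerD2l ler_pM2r// ler_nat. Qed.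

Let node_last n : node n n.+1 = b.
Proof. by rewrite /node /h mulrC divfK// addrC subrK. Qed.

(** The cells of the uniform grid with n + 1 steps that lie inside U form a
    nonoverlapping list, so that absolute continuity applies to them; they
    exhaust the part of the open set U in ]a, b] as n grows. *)
Let cells U n : seq (R * R) :=
  [seq (node n j, node n j.+1) |
    j <- [seq j <- iota 0 n.+1 | asbool (`]node n j, node n j.+1]%classic `<=` U)]].

Let cells_nonoverlapping U n : nonoverlapping (cells U n).
Proof.
rewrite /nonoverlapping /cells all_map pairwise_map; apply/andP; split.
  by apply/allP => j _ /=; exact: node_nd.
apply: (@pairwise_filter _ (relpre (fun j => (node n j, node n j.+1))
  (fun p q : R * R => p.2 <= q.1))).
apply: (@sub_pairwise _ ltn) => [j k jk/=|]; first exact: node_nd.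
by rewrite -sorted_pairwise ?iota_ltn_sorted//; exact: ltn_trans.
Qed.

Let cells_sub U n : subitvs a b (cells U n).
Proof.
rewrite /subitvs /cells all_map; apply/allP => j; rewrite mem_filter mem_iota add0n.
move=> /= /andP[_ jn].
apply/andP; split; first by rewrite /node lerDl mulr_ge0// ltW.
by rewrite -[leRHS](node_last n) node_nd.
Qed.

Let cover_cells U n : cover_of (cells U n) `<=` U.
Proof.
move=> x /mem_cover_of[_ /mapP[j + ->]/=].
by rewrite mem_filter => /andP[/asboolP jU _] /jU.
Qed.

Let cover_cells_near U x : open U -> U x -> a < x <= b ->
  exists N, forall n, (N <= n)%N -> cover_of (cells U n) x.
Proof.
move=> oU Ux /andP[ax xb].
have /nbhs_ballP[r /= r0 rU] : nbhs x U by apply: open_nbhs_nbhs.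
exists (Num.truncn ((b - a) / r)) => n Nn.
have hr : h n < r.
  rewrite /h ltr_pdivrMr// mulrC -ltr_pdivrMr//.
  by apply: lt_le_trans (truncnS_gt _) _; rewrite ler_nat ltnS.
have ex : exists k, x <= node n k by exists n.+1; rewrite node_last.
case: (ex_minnP ex) => -[|k].
  by rewrite /node mul0r addr0 leNgt ax.
move=> xk kmin.
have kn : (k < n.+1)%N by apply: kmin; rewrite node_last.
have kx : node n k < x.
  by rewrite ltNge; apply/negP => /kmin; rewrite ltnn.
apply/mem_cover_of; exists (node n k, node n k.+1); last by rewrite kx.
apply/mapP; exists k => //; rewrite mem_filter mem_iota add0n kn leq0n/= andbT.
apply/asboolP => y /=; rewrite in_itv/= => /andP[ky yk].
apply: rU; rewrite /ball/= ltr_distlC.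
move: xk yk; rewrite nodeS => xk yk.
by apply/andP; split; lra.
Qed.

(** The sets covered by the n-th cells need not increase with n, but their
    intersections W m over n >= m increase with m, and their union contains
    the part of U in ]a, b]. *)
Let stieltjes_open U (d e : R) : open U -> (leb R U < d%:E)%E ->
  (forall s, nonoverlapping s -> subitvs a b s -> total_length s < d ->
      \sum_(p <- s) `|g p.2 - g p.1| < e) ->
  (mu (U `&` `]a, b]%classic) <= e%:E)%E.
Proof.
move=> oU Ud H.
have mU : measurable U by exact: open_measurable.
have cell_le n : (mu (cover_of (cells U n)) <= e%:E)%E.
  rewrite /mu stieltjes_cover_of ?cells_nonoverlapping//.
  have len : total_length (cells U n) < d.
    have lenE : (leb R (cover_of (cells U n)) = (total_length (cells U n))%:E)%E.
      exact: (stieltjes_cover_of idfun (cells_nonoverlapping U n)).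
    rewrite -lte_fin -lenE; apply: (le_lt_trans _ Ud).
    rewrite le_measure ?inE//. exact: measurable_cover_of.
  rewrite lee_fin; apply/ltW.
  apply: le_lt_trans (H _ (cells_nonoverlapping U n) (cells_sub U n) len).
  rewrite big_seq [leRHS]big_seq; apply: ler_sum => p ps.
  have /andP[ap pb] := allP (cells_sub U n) _ ps.
  have p12 : p.1 <= p.2.
    by have /andP[/allP + _] := cells_nonoverlapping U n; exact.
  by rewrite !GE ?ler_norm ?(le_trans ap)// (le_trans p12).
pose W m := \bigcap_(n in [set n | (m <= n)%N]) cover_of (cells U n).
have mW m : measurable (W m).
  by apply: bigcap_measurable => [|n _]; [exists m => /=|exact: measurable_cover_of].
have ndW : nondecreasing_seq W.
  move=> m m' mm'; apply/subsetPset => x Wx n /= m'n; apply: Wx => /=.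
  exact: leq_trans m'n.
have cvg := nondecreasing_cvg_mu (mu := mu) mW (bigcup_measurable (fun n _ => mW n)) ndW.
apply: (@le_trans _ _ (mu (\bigcup_n W n))).
  rewrite le_measure ?inE//.
  - exact: measurableI.
  - by apply: bigcup_measurable => k _; exact: mW.
  - move=> x [Ux]; rewrite /= in_itv/= => xab.
    have [N HN] := cover_cells_near oU Ux xab.
    by exists N => // n /= Nn; exact: HN.
have -> : mu (\bigcup_n W n) = limn (mu \o W) by apply/esym/cvg_lim => //; exact: cvg.
apply: lime_le; first by apply/cvg_ex; eexists; exact: cvg.
apply: nearW => n; apply: le_trans (cell_le n); rewrite le_measure ?inE//.
- exact: mW.
- exact: measurable_cover_of.
- by move=> x; apply => /=.
Qed.

(** A null set lies in open sets of arbitrarily small length. *)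
Let stieltjes_null N : measurable N -> leb R N = 0%E -> mu (N `&` `]a, b]%classic) = 0%E.
Proof.
move=> mN N0; apply/eqP; rewrite eq_le measure_ge0 andbT.
apply/lee_addgt0Pr => e e0; rewrite add0e.
have [d d0 H] := ac e0.
have Noo : (leb R N < +oo)%E by rewrite N0.
have [U [oU NU Ud]] := lebesgue_regularity_outer mN Noo d0.
have mU : measurable U by exact: open_measurable.
apply: le_trans (stieltjes_open oU _ H).
  rewrite le_measure ?inE//; [exact: measurableI|exact: measurableI|].
  exact: setSI.
apply: le_lt_trans Ud; rewrite -{1}(setDUK NU) measureU//; last 2 first.
- exact: measurableD.
- by rewrite setDIK.
by rewrite [X in (X + _)%E]N0 add0e.
Qed.

(** Absolute continuity of g makes its Stieltjes measure dominated by Lebesgue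
    measure; the density is the Radon-Nikodym derivative. *)
Lemma nondecreasing_abs_cont_density : exists k : R -> R,
  (leb R).-integrable setT (EFin \o k) /\
  forall t, a <= t <= b ->
    ((g t - g a)%:E = \int[leb R]_(x in `]a, t]) (k x)%:E)%E.
Proof.
have mI : measurable (`]a, b]%classic : set (measurableTypeR R)) by exact: measurable_itv.
have muE t : a <= t <= b -> (mu `]a, t]%classic = (g t - g a)%:E)%E.
  by move=> /andP[at_ tb]; rewrite /mu stieltjes_itvoc ?GE// ltW.
have muoo : (mu `]a, b]%classic < +oo)%E.
  by rewrite muE ?ltry// lexx (ltW ab).
have dom : mfrestr mI muoo `<< leb R.
  by apply/null_content_dominatesP => N mN; exact: stieltjes_null.
have [k [k0 kfin ki kE]] := radon_nikodym_sigma_finite dom.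
exists (fine \o k).
have kk : EFin \o (fine \o k) = k by apply/funext => x /=; rewrite fineK.
rewrite kk; split => // t tab.
rewrite -muE//.
have -> : (\int[leb R]_(x in `]a, t]) ((fine \o k) x)%:E =
           \int[leb R]_(x in `]a, t]) k x)%E.
  by apply: eq_integral => x _; rewrite -[in RHS]kk.
rewrite -kE//= /mfrestr /mrestr; congr (mu _); apply/seteqP; split => x /=.
  rewrite !in_itv/= => /andP[ax xt]; rewrite ax xt; split => //.
  by case/andP: tab => _; exact: le_trans.
by case.
Qed.

End dominated.
End stieltjes.

(** * Fundamental theorem of calculus for absolutely continuous functions *)

Section abs_cont_FTC.
Context (R : realType).
Local Notation mu := (leb R).

(** Jordan decomposition f = v - (v - f), with v the variation function. *)
Lemma seq_abs_cont_density (a b : R) (f : R -> R) : a < b ->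
  seq_abs_cont a b f -> exists k : R -> R,
  mu.-integrable setT (EFin \o k) /\
  forall t, a <= t <= b -> f t - f a = \int[mu]_(x in `[a, t]) k x.
Proof.
move=> ab ac; have ab' := ltW ab.
pose v t := fine (total_variation a t f).
have acv : seq_abs_cont a b v by exact: seq_abs_cont_fine_total_variation.
have ndv u w : a <= u -> u <= w -> w <= b -> v u <= v w.
  exact: (fine_total_variation_nondecreasing ab' ac).
have ndvf u w : a <= u -> u <= w -> w <= b -> (v \- f) u <= (v \- f) w.
  move=> au uw wb /=.
  have := le_trans (ler_norm _) (le_fine_total_variation ab' ac au uw wb).
  by rewrite -/(v u) -/(v w); lra.
have [k1 [ik1 k1E]] := nondecreasing_abs_cont_density ab ndv acv.
have [k2 [ik2 k2E]] := nondecreasing_abs_cont_density ab ndvf (seq_abs_contB acv ac).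
exists (k1 \- k2); split.
  rewrite (_ : EFin \o _ = (EFin \o k1) \- (EFin \o k2))%E; last exact/funext.
  exact: integrableB.
move=> t tab.
have sub : (mu.-integrable `[a, t] (EFin \o k1)) /\ (mu.-integrable `[a, t] (EFin \o k2)).
  by split; apply: integrableS; [| | |exact: ik1| | | |exact: ik2].
have E k c : ((c%:E = \int[mu]_(x in `]a, t]) (k x)%:E)%E -> 
  mu.-integrable setT (EFin \o k) -> \int[mu]_(x in `[a, t]) k x = c).
  move=> kc ik; rewrite -Rintegral_itv_obnd_cbnd//; last first.
    exact: integrableS ik.
  by rewrite /Rintegral -kc.
rewrite RintegralB//; [|by case: sub|by case: sub].
rewrite (E _ _ (k1E _ tab) ik1) (E _ _ (k2E _ tab) ik2) /=.
ring.
Qed.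

(** The density k replaces the derivative in integrals: unlike the pointwise
    derivative, it is known to be Borel measurable. *)
Theorem abs_cont_FTC (a b : R) (f : R -> R) : a < b -> abs_cont a b f ->
  exists k : R -> R, [/\ mu.-integrable setT (EFin \o k),
    forall t, a <= t <= b -> f t - f a = \int[mu]_(x in `[a, t]) k x &
    {ae mu, forall t, t \in `[a, b] -> derive1 f t = k t}].
Proof.
move=> ab /abs_cont_seq/(seq_abs_cont_density ab)[k [ik kE]].
exists k; split => //.
have ik' y : mu.-integrable [set` Interval (BLeft a) (BRight y)] (EFin \o k).
  exact: integrableS ik.
have lk : locally_integrable setT k by apply: open_integrable_locally => //; exact: openT.
have ae_neq c : {ae mu, forall t, t != c}.
  exists [set c]; split; [exact: measurable_set1|exact: lebesgue_measure_set1|].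
  by move=> t /= /negP; rewrite negbK => /eqP.
apply: (@filterS3 _ _ (ae_filter_ringOfSetsType mu) _ _ _ _ _ (FTC1 ik' lk) (ae_neq a) (ae_neq b)).
move=> t /= H ta tb; rewrite in_itv/= => /andP[at_ tb'].
have {}ta : a < t by rewrite lt_neqAle eq_sym ta.
have {}tb : t < b by rewrite lt_neqAle tb.
have [|dF <-] := H; first by rewrite lte_fin.
rewrite !derive1E.
rewrite (@near_eq_derive _ _ _ f (fun x => \int[mu]_(t in `[a, x]) k t + f a)); last first.
  have tI : t \in `]a, b[ by rewrite in_itv/= ta tb.
  have := near_in_itvoo tI; apply: filterS => x; rewrite in_itv/= => /andP[ax xb].
  by rewrite -kE ?subrK// (ltW ax) (ltW xb).
by rewrite (deriveD dF (derivable_cst _ _ _)) derive_cst addr0.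
Qed.

End abs_cont_FTC.

(** * Abel inversion *)

Section abel_equation.
Context (R : realType).
Local Notation mu := (leb R).
Local Open Scope ereal_scope.

Lemma measurable_fun_integral2 (H : R * R -> \bar R) : measurable_fun setT H ->
  measurable_fun setT (fun s => \int[mu]_r H (s, r)).
Proof.
move=> mH.
have -> : (fun s => \int[mu]_r H (s, r)) =
    (fun s => \int[mu]_r H^\+ (s, r)) \- (fun s => \int[mu]_r H^\- (s, r)).
  apply/funext => s; rewrite [LHS]integralE.
  under eq_integral do rewrite funepos_comp/=.
  by under [X in _ - X = _]eq_integral do rewrite funeneg_comp/=.
apply: emeasurable_funB.
- by apply: (@measurable_fun_fubini_tonelli_F _ _ _ _ _ mu H^\+) => //; exact: measurable_funepos.
- by apply: (@measurable_fun_fubini_tonelli_F _ _ _ _ _ mu H^\-) => //; exact: measurable_funeneg.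
Qed.

Variables (p q : R).
Hypotheses (p01 : (0 < p < 1)%R) (pq : (p + q = 1)%R).

Let p01' : (0 < p <= 1)%R. Proof. by case/andP: p01 => -> /ltW. Qed.
Let q01' : (0 < q <= 1)%R. Proof. by move: p01 pq => /andP[? ?] ?; apply/andP; split; lra. Qed.

Let beta_ge0 : 0 <= beta p q.
Proof. by apply: integral_ge0 => s _; rewrite lee_fin mulr_ge0 ?abel_ge0. Qed.

Let beta_fin : beta p q = (fine (beta p q))%:E.
Proof.
by rewrite fineK// ge0_fin_numE ?beta_lty.
Qed.

Variables (y : R -> R).
Hypothesis iy : mu.-integrable setT (EFin \o y).

Let my : measurable_fun setT y.
Proof. by apply/measurable_EFinP; exact: measurable_int iy. Qed.

(** Up to the factor 1 / Gamma(q), the fractional integral of order q of y. *)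
Definition abel_transform (s : R) : R := fine (\int[mu]_r (abel q (s - r) * y r)%:E).

Let mkernel : measurable_fun setT (fun z : R * R => abel q (z.1 - z.2) * y z.2)%R.
Proof.
apply: measurable_funM.
  by apply: measurableT_comp; [exact: measurable_abel|apply: measurable_funB].
exact: measurableT_comp.
Qed.

Lemma measurable_abel_transform : measurable_fun setT abel_transform.
Proof.
apply: measurableT_comp => //.
apply: (@measurable_fun_integral2 (fun z : R * R => (abel q (z.1 - z.2) * y z.2)%:E)).
exact/measurable_EFinP.
Qed.

(** Fractional integrals of orders p and q = 1 - p compose to a multiple of the
    ordinary integral. Absolute integrability on the plane comes from Tonelli's
    theorem, where integrating out s first leaves the constant [beta p q]. *)
Lemma abel_inversion t :
  mu.-integrable setT (fun s : R => (abel p (t - s) * abel_transform s)%:E) /\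
  \int[mu]_s (abel p (t - s) * abel_transform s)%:E =
    beta p q * \int[mu]_(r in `]-oo, t]) (y r)%:E.
Proof.
pose H (z : R * R) : \bar R := (abel p (t - z.1) * (abel q (z.1 - z.2) * y z.2))%:E.
have mH : measurable_fun setT H.
  apply/measurable_EFinP; apply: measurable_funM => //.
  by apply: measurableT_comp; [exact: measurable_abel|apply: measurable_funB].
have mabs (r : R) : measurable_fun setT (fun s : R => (abel p (t - s) * abel q (s - r))%:E).
  apply/measurable_EFinP; apply: measurable_funM;
    by apply: measurableT_comp; [exact: measurable_abel|apply: measurable_funB].
have iH : (mu \x mu).-integrable setT H.
  apply/(integrable21ltyP mu mu mH).
  apply: (@le_lt_trans _ _ (\int[mu]_r (beta p q * `|(y r)%:E|))).
    apply: ge0_le_integral => //.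
    - by move=> r _; exact: integral_ge0.
    - apply: (@measurable_fun_fubini_tonelli_G _ _ _ _ _ mu (abse \o H)).
        exact: measurableT_comp.
      by move=> z; exact: abse_ge0.
    - by apply: measurable_funeM; apply/measurable_EFinP; exact: measurableT_comp.
    move=> r _.
    rewrite (_ : \int[mu]_s _ =
      \int[mu]_s (`|y r|%:E * (abel p (t - s) * abel q (s - r))%:E)); last first.
      apply: eq_integral => s _; rewrite /H/= -EFinM mulrA normrM mulrC.
      by rewrite [in RHS]mulrC mulrC; congr (_ * _)%:E; rewrite ger0_norm// mulr_ge0 ?abel_ge0.
    rewrite ge0_integralZl//; [|exact: mabs|by move=> s _; rewrite lee_fin mulr_ge0 ?abel_ge0].
    rewrite abel_convolution// muleC; apply: lee_pmul => //.
      by case: ifP.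
    by case: ifP.
  rewrite ge0_integralZl//.
  - rewrite beta_fin; apply: lte_mul_pinfty => //.
      by rewrite lee_fin fine_ge0.
    by case/integrableP: iy.
  - by apply/measurable_EFinP; exact: measurableT_comp.
(* For almost every s the inner integral converges absolutely, so the factor
   depending on s alone can be pulled out and [fine] is harmless. *)
have HE : {ae mu, forall s : R, \int[mu]_r H (s, r) = (abel p (t - s) * abel_transform s)%:E}.
  apply: (filterS _ (ae_integrable1 iH)) => s iHs.
  have [ts|st] := leP t s.
    rewrite abel_le0E ?subr_le0// mul0r integral0_eq// => r _.
    by rewrite /H/= abel_le0E ?subr_le0// mul0r.
  have p0 : (abel p (t - s) != 0)%R by rewrite gt_eqF// abel_gt0E ?powR_gt0 ?subr_gt0.
  have isr : mu.-integrable setT (fun r : R => (abel q (s - r) * y r)%:E).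
    have := integrableZl measurableT (abel p (t - s))^-1 iHs.
    by apply: eq_integrable => // r _; rewrite /H/= -EFinM mulKf.
  rewrite /H/=; under eq_integral do rewrite EFinM.
  rewrite integralZl// EFinM; congr (_ * _).
  by rewrite /abel_transform fineK//; exact: integrable_fin_num.
have iF := integrable_fubini_F iH.
have mT : measurable_fun setT (fun s : R => (abel p (t - s) * abel_transform s)%:E).
  apply/measurable_EFinP; apply: measurable_funM; last exact: measurable_abel_transform.
  by apply: measurableT_comp; [exact: measurable_abel|apply: measurable_funB].
have iabs (r : R) : mu.-integrable setT (fun s : R => (abel p (t - s) * abel q (s - r))%:E).
  apply/integrableP; split; first exact: mabs.
  under eq_integral do rewrite gee0_abs ?lee_fin ?mulr_ge0 ?abel_ge0//.
  by rewrite abel_convolution//; case: ifP => // _; rewrite beta_fin ltry.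
split.
  apply/integrableP; split => //; case/integrableP: iF => _.
  congr (_ < _); apply: ae_eq_integral_any.
  apply: (@filterS _ _ (ae_filter_ringOfSetsType mu) _ _ _ HE) => s sE _.
  by rewrite /fubini_F sE.
transitivity (\int[mu]_s \int[mu]_r H (s, r)).
  apply: ae_eq_integral_any.
  by apply: (@filterS _ _ (ae_filter_ringOfSetsType mu) _ _ _ HE) => s ->.
rewrite (integral12_prod_meas1 iH) -(integral21_prod_meas1 iH).
rewrite -integral_itv_bndo_bndc; last by apply: measurable_funTS; apply/measurable_EFinP.
rewrite beta_fin -integralZl//; last exact: integrableS iy.
rewrite [RHS]integral_mkcond; apply: eq_integral => r _.
rewrite /fubini_G /H/= patchE.
under eq_integral do rewrite mulrA mulrC EFinM.
rewrite integralZl// abel_convolution// muleC -beta_fin.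
have -> : (r \in `]-oo, t[%classic) = (r < t)%R by rewrite mem_setE in_itv.
by case: ifP => // _; rewrite mul0e.
Qed.

End abel_equation.

(** * From the Caputo derivative to a Volterra equation *)

Section volterra.
Context (R : realType).
Local Notation mu := (leb R).
Implicit Types (a b p t : R) (g C : R -> R).

(** Equal to 1 / Gamma(p), by Euler's formula for the Beta integral. *)
Definition volterra_const p : R := Gamma (1 - p) / fine (beta p (1 - p)).

Lemma volterra_const_ge0 p : 0 < p < 1 -> 0 <= volterra_const p.
Proof.
move=> /andP[p0 p1]; rewrite divr_ge0//.
  by rewrite ltW// Gamma_gt0// subr_gt0 p1/= lerBlDr lerDl ltW.
by rewrite fine_ge0//; apply: integral_ge0 => s _; rewrite lee_fin mulr_ge0 ?abel_ge0.
Qed.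

(** The increments of g are [volterra_const p] times the convolution of the
    Abel kernel with C. The integral runs over the whole line: the kernel
    vanishes for s > t, and in the applications C vanishes for s < a. *)
Definition volterra a b p g C : Prop :=
  measurable_fun setT C /\ forall t, a <= t <= b ->
    mu.-integrable setT (fun s : R => (abel p (t - s) * C s)%:E) /\
    g t - g a = volterra_const p * \int[mu]_s (abel p (t - s) * C s).

Lemma volterraB a b p g1 g2 C1 C2 :
  volterra a b p g1 C1 -> volterra a b p g2 C2 ->
  volterra a b p (g1 \- g2) (C1 \- C2).
Proof.
move=> [mC1 v1] [mC2 v2]; split; first exact: measurable_funB.
move=> t tab; have [i1 E1] := v1 _ tab; have [i2 E2] := v2 _ tab.
have E : (fun s : R => (abel p (t - s) * (C1 \- C2) s)%:E) =
    ((fun s : R => (abel p (t - s) * C1 s)%:E) \- (fun s : R => (abel p (t - s) * C2 s)%:E))%E.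
  by apply/funext => s /=; rewrite mulrBr EFinB.
split; first by rewrite E; exact: integrableB.
rewrite (_ : _ - _ = (g1 t - g1 a) - (g2 t - g2 a)); last by rewrite /=; ring.
rewrite E1 E2 -mulrBr; congr (_ * _); rewrite -RintegralB//.
by apply: eq_Rintegral => s _; rewrite mulrBr.
Qed.

(** Abel inversion applied to the density of g, cut off to [a, b]; the C
    obtained is the Caputo derivative on [a, b], where it is Borel measurable
    as a parametrized integral. *)
Lemma Caputo_volterra a b p g : a < b -> 0 < p < 1 -> abs_cont a b g ->
  exists C, [/\ volterra a b p g C, forall s, s < a -> C s = 0 &
    forall s, a <= s <= b -> RL_left a (1 - p) (derive1 g) s = C s].
Proof.
move=> ab p01 /(abs_cont_FTC ab)[k [ik kE kg]].
have /andP[p0 p1] := p01.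
pose q := 1 - p.
have q01 : 0 < q <= 1 by rewrite subr_gt0 p1/= lerBlDr lerDl ltW.
have pq : p + q = 1 by rewrite addrC subrK.
have G0 : 0 < Gamma q by exact: Gamma_gt0.
have beta_fin : (beta p q = (fine (beta p q))%:E)%E.
  rewrite fineK// ge0_fin_numE ?beta_lty// ?p0 ?(ltW p1)//.
  by apply: integral_ge0 => s _; rewrite lee_fin mulr_ge0 ?abel_ge0.
have beta_gt0 : 0 < fine (beta p q).
  rewrite -lte_fin -beta_fin; apply: (@lt_le_trans _ _ 1%E) => //.
  by apply: beta_ge1; [exact: ltW|case/andP: q01].
pose y := k \_ `[a, b].
have iy : mu.-integrable setT (EFin \o y).
  rewrite /y -restrict_EFin; apply/integrable_restrict => //.
  by rewrite setTI; exact: integrableS ik.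
pose C s := (Gamma q)^-1 * abel_transform q y s.
have mC : measurable_fun setT C.
  by apply: measurable_funM => //; exact: measurable_abel_transform.
exists C; split.
- split=> // t /andP[at_ tb].
  have [iT TE] := abel_inversion p01 pq iy t.
  have CT s : abel p (t - s) * C s = (Gamma q)^-1 * (abel p (t - s) * abel_transform q y s).
    by rewrite /C mulrCA.
  split.
    rewrite (_ : (fun s : R => _) = (fun s : R =>
      (Gamma q)^-1%:E * (abel p (t - s) * abel_transform q y s)%:E)%E); last first.
      by apply/funext => s; rewrite CT EFinM.
    exact: integrableZl.
  under eq_Rintegral do rewrite CT.
  rewrite RintegralZl// /Rintegral TE.
  rewrite (_ : \int[mu]_(r in `]-oo, t]) (y r)%:E = (\int[mu]_(r in `[a, t]) k r)%:E)%E; last first.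
    rewrite /Rintegral fineK; last first.
      by apply: integrable_fin_num => //; exact: integrableS ik.
    rewrite [LHS]integral_mkcond [RHS]integral_mkcond; apply: eq_integral => r _.
    rewrite !patchE !mem_setE !in_itv/= /y patchE mem_setE in_itv/=.
    case: (leP r t) => rt; rewrite ?andbF//= andbT (le_trans rt tb) andbT.
    by case: ifP.
  rewrite -kE ?at_// beta_fin/= /volterra_const -/q.
  by field; rewrite !gt_eqF.
- move=> s sa; rewrite /C /abel_transform integral0_eq ?mulr0// => r _.
  rewrite /y patchE mem_setE in_itv/=; have [ar|ra] := leP a r; last by rewrite mulr0.
  by rewrite abel_le0E ?mul0r// subr_le0 (le_trans (ltW sa)).
move=> s /andP[as_ sb]; rewrite /RL_left /C /abel_transform -/q; congr (_ * fine _).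
rewrite (@ae_eq_integral_any _ _ _ mu `[a, s]%classic _
  (fun r : R => (abel q (s - r) * k r)%:E)); last first.
  apply: (@filterS _ _ (ae_filter_ringOfSetsType mu) _ _ _ kg) => r H.
  rewrite /= in_itv/= => /andP[ar rs]; rewrite H; last by rewrite in_itv/= ar (le_trans rs).
  by rewrite ge0_abelE ?subr_ge0// /q lt_eqF// ltrBlDr ltrDl.
rewrite integral_mkcond; apply: eq_integral => r _.
rewrite patchE mem_setE in_itv/= /y patchE mem_setE in_itv/=.
have [ar|ra] := leP a r; last by rewrite mulr0.
have [rs|sr] := leP r s; first by rewrite (le_trans rs sb).
by rewrite /= abel_le0E ?mul0r// subr_le0 ltW.
Qed.

(** The majorant phi may depend on t: this is what allows exponential weights
    centred at t below. *)
Lemma volterra_le a b p g C (phi : R -> R) t : 0 < p < 1 -> a <= t <= b ->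
  volterra a b p g C -> (forall s, s < a -> C s = 0) ->
  (forall s, 0 <= phi s) -> measurable_fun setT phi ->
  {ae mu, forall s, a <= s <= b -> `|C s| <= phi s} ->
  (`|g t - g a|%:E <= (volterra_const p)%:E * \int[mu]_s (abel p (t - s) * phi s)%:E)%E.
Proof.
move=> p01 tab [mC v] C0 phi0 mphi Cphi; have [i ->] := v _ tab.
have k0 := volterra_const_ge0 p01.
rewrite normrM (ger0_norm k0) EFinM; apply: lee_wpmul2l; first by rewrite lee_fin.
have mabel : measurable_fun setT (fun s : R => abel p (t - s)).
  by apply: measurableT_comp; [exact: measurable_abel|apply: measurable_funB].
have mi := measurable_int mu i.
rewrite EFin_normr_Rintegral//; apply: (le_trans (le_abse_integral mu measurableT mi)).
apply: ae_ge0_le_integral => //.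
- exact: measurableT_comp.
- by move=> s _; rewrite lee_fin mulr_ge0 ?abel_ge0.
- by apply/measurable_EFinP; exact: measurable_funM.
apply: (@filterS _ _ (ae_filter_ringOfSetsType mu) _ _ _ Cphi) => s H _.
rewrite /= lee_fin normrM (ger0_norm (abel_ge0 _ _)).
have [sa|as_] := ltP s a; first by rewrite C0// normr0 mulr0 mulr_ge0 ?abel_ge0.
have [st|ts] := ltP s t; last by rewrite abel_le0E ?subr_le0// !mul0r.
rewrite ler_wpM2l ?abel_ge0// H// as_/= (le_trans (ltW st))//.
by case/andP: tab.
Qed.

End volterra.

(** * Bounds for solutions of the Volterra equation *)

Section kernel_bounds.
Context (R : realType).
Local Notation mu := (leb R).
Implicit Types (a b p t x : R) (g C : R -> R).

Let measurable_abel_sub p t : measurable_fun setT (fun s : R => abel p (t - s)).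
Proof. by apply: measurableT_comp; [exact: measurable_abel|apply: measurable_funB]. Qed.

Let measurable_exp_sub t x : measurable_fun setT (fun s : R => expR (- ((t - s) / x))).
Proof.
apply: measurableT_comp => //; apply: measurable_funN; apply: measurable_funM => //.
exact: measurable_funB.
Qed.

Lemma integral_abel_exp p x t : 0 < p <= 1 -> 0 < x ->
  (\int[mu]_s (abel p (t - s) * expR (- ((t - s) / x)))%:E = (x `^ p * Gamma p)%:E)%E.
Proof.
move=> p01 x0; have xV0 : 0 < x^-1 by rewrite invr_gt0.
under eq_integral do rewrite [_ / x]mulrC.
rewrite laplace_abel//; congr (_ * _)%:E.
by rewrite -[x^-1]powR_inv1 ?(ltW x0)// -powRrM mulrN mulN1r opprK.
Qed.

(** Where t - s > x the kernel is at most x^(p - 1), and elsewhere it is at most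
    exp(1) times the kernel damped by exp(-(t - s) / x); each part contributes a
    multiple of x^p, wherever the interval lies. *)
Lemma integral_abel_itv_le p tau t x : 0 < p <= 1 -> 0 < x ->
  (\int[mu]_s (abel p (t - s) * \1_(`[tau, tau + x[%classic) s)%:E <=
    (x `^ p * (1 + expR 1 * Gamma p))%:E)%E.
Proof.
move=> p01 x0; have /andP[p0 p1] := p01.
have mI : measurable (`[tau, tau + x[%classic : set R) by exact: measurable_itv.
pose ind : R -> R := \1_(`[tau, tau + x[%classic : set R).
have mind : measurable_fun setT ind by exact: measurable_indic.
rewrite -/ind.
pose F s := ((abel p x)%:E * (ind s)%:E +
  (expR 1)%:E * (abel p (t - s) * expR (- ((t - s) / x)))%:E)%E.
have m1 : measurable_fun setT (fun s : R => (ind s)%:E).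
  by apply/measurable_EFinP; exact: mind.
have m2 : measurable_fun setT (fun s : R => (abel p (t - s) * expR (- ((t - s) / x)))%:E).
  by apply/measurable_EFinP; exact: measurable_funM.
have p1E : abel p x * x = x `^ p.
  by rewrite abel_gt0E// mulrC mulr_powRB1// ltW.
apply: (@le_trans _ _ (\int[mu]_s F s)%E).
  apply: ge0_le_integral => //.
  - by move=> s _; rewrite lee_fin mulr_ge0 ?abel_ge0.
  - apply/measurable_EFinP. apply: measurable_funM; [exact: measurable_abel_sub|exact: mind].
  - apply: emeasurable_funD; first exact: (measurable_funeM (abel p x)%:E m1).
    exact: (measurable_funeM (expR 1)%:E m2).
  move=> s _; rewrite /F -!EFinM -EFinD lee_fin.
  have e0 : 0 <= expR 1 * (abel p (t - s) * expR (- ((t - s) / x))).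
    by rewrite !mulr_ge0 ?expR_ge0 ?abel_ge0.
  have i0 : 0 <= ind s by rewrite /ind.
  have i1 : ind s <= 1 by rewrite /ind indicE lern1 leq_b1.
  have [tsx|xts] := leP (t - s) x.
    apply: ler_wpDl; first by rewrite mulr_ge0 ?abel_ge0.
    apply: (@le_trans _ _ (abel p (t - s))); first by rewrite ler_piMr ?abel_ge0.
    rewrite mulrCA -expRD ler_peMr ?abel_ge0// -[leLHS]expR0 ler_expR.
    by rewrite subr_ge0 ler_pdivrMr// mul1r.
  apply: ler_wpDr => //; rewrite ler_wpM2r//.
  by apply: abel_nincr => //; exact: ltW.
rewrite ge0_integralD//=; last 4 first.
- by move=> s _; rewrite -EFinM lee_fin mulr_ge0 ?abel_ge0.
- exact: measurable_funeM.
- by move=> s _; rewrite -EFinM lee_fin !mulr_ge0 ?expR_ge0 ?abel_ge0.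
- exact: measurable_funeM.
rewrite ge0_integralZl//=; last 2 first.
- by move=> s _; rewrite lee_fin.
- by rewrite lee_fin abel_ge0.
rewrite ge0_integralZl//=; last first.
  by move=> s _; rewrite lee_fin mulr_ge0 ?expR_ge0 ?abel_ge0.
rewrite integral_abel_exp// integral_indic// setIT.
rewrite [X in (_ * X + _)%E](_ : _ = x%:E); last first.
  by rewrite /= lebesgue_measure_itv/= lte_fin ltrDl x0 -EFinB addrC addKr.
by rewrite -!EFinM -EFinD p1E mulrDr mulr1 mulrCA.
Qed.

(** As t - s <= b - a on [a, b], the constant M is at most
    M exp(b - a) exp(-(t - s)), whose convolution with the kernel is explicit. *)
Lemma volterra_bounded a b p g C t (M : R) : 0 < p < 1 -> a <= t <= b -> 0 <= M ->
  volterra a b p g C -> (forall s, s < a -> C s = 0) ->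
  {ae mu, forall s, a <= s <= b -> `|C s| <= M} ->
  `|g t - g a| <= volterra_const p * (M * expR (b - a) * Gamma p).
Proof.
move=> p01 tab M0 v C0 CM; have /andP[p0 p1] := p01; have /andP[at_ tb] := tab.
have p01' : 0 < p <= 1 by rewrite p0 ltW.
have c0 : 0 <= M * expR (b - a) by rewrite mulr_ge0 ?expR_ge0.
pose phi s := M * expR (b - a) * expR (- ((t - s) / 1)).
rewrite -lee_fin.
apply: (le_trans (volterra_le (phi := phi) p01 tab v C0 _ _ _)).
- by move=> s; rewrite mulr_ge0 ?expR_ge0.
- exact: measurable_funM.
- apply: (@filterS _ _ (ae_filter_ringOfSetsType mu) _ _ _ CM) => s H /[dup] sab /H.
  move=> /le_trans; apply; rewrite /phi -mulrA -expRD ler_peMr//.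
  rewrite -[leLHS]expR0 ler_expR divr1.
  by move: sab => /andP[as_ sb]; lra.
rewrite [leRHS]EFinM; apply: lee_wpmul2l; first by rewrite lee_fin volterra_const_ge0.
under eq_integral do rewrite /phi mulrCA EFinM.
rewrite ge0_integralZl//=; last 2 first.
- by apply/measurable_EFinP; apply: measurable_funM;
    [exact: measurable_abel_sub|exact: measurable_exp_sub].
- by move=> s _; rewrite lee_fin mulr_ge0 ?expR_ge0 ?abel_ge0.
by rewrite integral_abel_exp// powR1 mul1r.
Qed.

(** One step of the weighted Gronwall argument: exp((s - a) / x) factors as
    exp((t - a) / x) exp(-(t - s) / x), and the damping gains the factor x^p. *)
Lemma volterra_gronwall a b p g C t x (c1 c2 tau theta : R) :
  0 < p < 1 -> a <= t <= b -> 0 < x -> 0 <= c1 -> 0 <= c2 -> 0 < theta ->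
  volterra a b p g C -> (forall s, s < a -> C s = 0) ->
  {ae mu, forall s, a <= s <= b ->
    `|C s| <= c1 * expR ((s - a) / x) + c2 * \1_(`[tau, tau + theta[%classic) s} ->
  `|g t - g a| <= volterra_const p * (c1 * expR ((t - a) / x) * (x `^ p * Gamma p)
     + c2 * (theta `^ p * (1 + expR 1 * Gamma p))).
Proof.
move=> p01 tab x0 c10 c20 theta0 v C0 Cc; have /andP[p0 p1] := p01.
have p01' : 0 < p <= 1 by rewrite p0 ltW.
have mI : measurable (`[tau, tau + theta[%classic : set R) by exact: measurable_itv.
have mind : measurable_fun setT (\1_(`[tau, tau + theta[%classic) : R -> R).
  exact: measurable_indic.
have c0 : 0 <= c1 * expR ((t - a) / x) by rewrite mulr_ge0 ?expR_ge0.
pose phi s := c1 * expR ((t - a) / x) * expR (- ((t - s) / x)) +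
  c2 * \1_(`[tau, tau + theta[%classic) s.
rewrite -lee_fin.
apply: (le_trans (volterra_le (phi := phi) p01 tab v C0 _ _ _)).
- by move=> s; rewrite addr_ge0// mulr_ge0 ?expR_ge0.
- by apply: measurable_funD; exact: measurable_funM.
- apply: (@filterS _ _ (ae_filter_ringOfSetsType mu) _ _ _ Cc) => s H /H.
  rewrite /phi -mulrA -expRD -mulrBl.
  by rewrite (_ : t - a - (t - s) = s - a)//; ring.
rewrite [leRHS]EFinM; apply: lee_wpmul2l; first by rewrite lee_fin volterra_const_ge0.
pose ind : R -> R := \1_(`[tau, tau + theta[%classic : set R).
pose F1 s := (abel p (t - s) * expR (- ((t - s) / x)))%:E.
pose F2 s := (abel p (t - s) * ind s)%:E.
have mF1 : measurable_fun setT F1.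
  by apply/measurable_EFinP; apply: measurable_funM;
    [exact: measurable_abel_sub|exact: measurable_exp_sub].
have mF2 : measurable_fun setT F2.
  by apply/measurable_EFinP; apply: measurable_funM; [exact: measurable_abel_sub|exact: mind].
have F10 s : (0 <= F1 s)%E by rewrite lee_fin mulr_ge0 ?expR_ge0 ?abel_ge0.
have F20 s : (0 <= F2 s)%E by rewrite lee_fin mulr_ge0 ?abel_ge0.
under eq_integral => s _.
  rewrite (_ : _%:E = (c1 * expR ((t - a) / x))%:E * F1 s + c2%:E * F2 s)%E; last first.
    by rewrite /F1 /F2 -!EFinM -EFinD /phi -/ind; congr EFin; ring.
  over.
rewrite ge0_integralD//=; last 4 first.
- by move=> s _; apply: mule_ge0.
- exact: measurable_funeM.
- by move=> s _; apply: mule_ge0.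
- exact: measurable_funeM.
rewrite ge0_integralZl//= ge0_integralZl//= EFinD !(EFinM (c1 * _)) (EFinM c2).
rewrite integral_abel_exp//; apply: leeD => //; apply: lee_wpmul2l => //.
exact: integral_abel_itv_le.
Qed.

End kernel_bounds.

(** * Trajectories and needle variations *)

Section row_norm.
Context (R : realType) (n : nat).

Lemma row_entry_le (v : 'rV[R]_n) i : `|v 0 i| <= `|v|.
Proof.
by rewrite [leRHS]/Num.Def.normr /= mx_normrE; apply/bigmax_geP; right => /=; exists (0, i).
Qed.

Lemma row_norm_le (v : 'rV[R]_n) (c : R) : 0 <= c ->
  (forall i, `|v 0 i| <= c) -> `|v| <= c.
Proof.
move=> c0 vc; rewrite [leLHS]/Num.Def.normr /= mx_normrE; apply/bigmax_leP; split => //.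
by move=> [i j] _ /=; rewrite (ord1 i).
Qed.

Lemma abs_cont_entry (a b : R) (x : R -> 'rV[R]_n) i :
  abs_cont a b x -> abs_cont a b (fun t => x t 0 i).
Proof.
move=> xab e /xab[d d0 H]; exists d => // k l r lr tlr lrd.
apply: le_lt_trans (H k l r lr tlr lrd); apply: ler_sum => j _.
by have := row_entry_le (x (r j) - x (l j)) i; rewrite !mxE.
Qed.

End row_norm.

Lemma near_powR_le (R : realType) (p c e : R) : 0 < p -> 0 <= c -> 0 < e ->
  \forall x \near 0^'+, c * x `^ p <= e.
Proof.
move=> p0 c0 e0; have c1 : 0 < c + 1 by rewrite ltr_wpDl.
have ec : 0 < e / (c + 1) by rewrite divr_gt0.
have h : (x `^ p) @[x --> (0:R)^'+] --> (0:R) := powR_cvg0 p0.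
near=> x; apply: (@le_trans _ _ (c * (e / (c + 1)))).
  by rewrite ler_wpM2l//; near: x; exact: (cvgr_le 0 h _ ec).
by rewrite mulrA ler_pdivrMr// mulrC ler_wpM2l ?(ltW e0)// lerDl.
Unshelve. all: by end_near. Qed.

Section trajectories.
Context (R : realType) (n m : nat) (a b : R) (alpha : 'I_n -> R).
Context (f : R -> 'rV[R]_n -> 'rV[R]_m -> 'rV[R]_n).
Context (Omega : set 'rV[R]_m) (xa : 'rV[R]_n).
Hypothesis ab : a < b.
Hypothesis alpha01 : forall i, 0 < alpha i < 1.
Variable M : R.
Hypothesis M0 : 0 <= M.
Hypothesis fM : forall t x u, t \in `[a, b] -> Omega u -> `|f t x u| <= M.

Local Notation kappa i := (volterra_const (alpha i)).
Local Notation G i := (Gamma (alpha i)).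

Lemma trajectory_volterra u x i : state_trajectory a b alpha f xa u x ->
  exists C, [/\ volterra a b (alpha i) (fun t => x t 0 i) C,
    forall s, s < a -> C s = 0 &
    ae_itv a b (fun s => C s = f s (x s) (u s) 0 i)].
Proof.
move=> [[acx _] xf _].
have [C [vC C0 CE]] := Caputo_volterra ab (alpha01 i) (abs_cont_entry i acx).
exists C; split => //; apply: (@filterS _ _ (ae_filter_ringOfSetsType _) _ _ _ xf).
by move=> s H sab; rewrite -H// mxE CE.
Qed.

(** A bound on the displacement of all trajectories with controls in Omega; it
    provides the compact set on which a Lipschitz constant is taken. *)
Definition trajectory_radius : R :=
  \big[Order.max/0]_i (kappa i * (M * expR (b - a) * G i)).

Lemma trajectory_bounded u x t : state_trajectory a b alpha f xa u x ->
  ae_itv a b (fun t => Omega (u t)) -> a <= t <= b ->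
  forall i, `|x t 0 i - xa 0 i| <= trajectory_radius.
Proof.
move=> xu uO tab i; have [C [vC C0 CE]] := trajectory_volterra i xu.
have [_ _ <-] := xu.
apply: le_trans (le_bigmax _ _ i) => /=.
apply: (volterra_bounded (alpha01 i) tab M0 vC C0).
apply: (@filterS2 _ _ (ae_filter_ringOfSetsType _) _ _ _ _ CE uO) => s H Ou sab.
have sI : s \in `[a, b] by rewrite in_itv.
by rewrite H//; apply: le_trans (row_entry_le _ _) _; apply: fM => //; exact: Ou.
Qed.

Section gap.
Variables (K scale delta theta tau : R) (v : 'rV[R]_m).
Hypothesis K0 : 0 <= K.
Hypothesis fK : forall (x y : 'rV[R]_n) t u,
  (forall i, `|x 0 i - xa 0 i| <= trajectory_radius) ->
  (forall i, `|y 0 i - xa 0 i| <= trajectory_radius) ->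
  t \in `[a, b] -> Omega u -> `|f t x u - f t y u| <= K * `|x - y|.
Hypothesis scale_gt0 : 0 < scale.
Hypothesis contraction : forall i, kappa i * (K * (scale `^ alpha i * G i)) <= 2^-1.
Hypothesis delta0 : 0 <= delta.
Hypothesis theta_gt0 : 0 < theta.
Hypothesis source : forall i,
  kappa i * (2 * M * (theta `^ alpha i * (1 + expR 1 * G i))) <= delta.
Hypothesis Ov : Omega v.

(** The weighted supremum S of the gap satisfies S <= S / 2 + delta, and it is
    finite because both trajectories stay in a bounded set. *)
Lemma needle_gap us xs xt t :
  state_trajectory a b alpha f xa us xs ->
  ae_itv a b (fun t => Omega (us t)) ->
  state_trajectory a b alpha f xa (needle us tau v theta) xt ->
  a <= t <= b -> `|xt t - xs t| <= 2 * delta * expR ((b - a) / scale).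
Proof.
move=> xsT usO xtT tab.
have ntO : ae_itv a b (fun t => Omega (needle us tau v theta t)).
  apply: (@filterS _ _ (ae_filter_ringOfSetsType _) _ _ _ usO) => s Os sab.
  by rewrite /needle; case: ifP => // _; exact: Os.
pose E s := expR ((s - a) / scale).
have E_gt0 s : 0 < E s by exact: expR_gt0.
have r0 : 0 <= trajectory_radius by exact: bigmax_ge_id.
(* The weight E grows with s; A collects the weighted gaps. *)
pose A := [set `|xt s - xs s| / E s | s in `[a, b]%classic].
have E1 s : a <= s -> 1 <= E s.
  by move=> as_; rewrite /E -[leLHS]expR0 ler_expR divr_ge0 ?subr_ge0// ltW.
have gapS s : a <= s <= b -> A (`|xt s - xs s| / E s).
  by move=> sab; exists s => //=; rewrite in_itv.
have ubA : has_ubound A.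
  exists (trajectory_radius + trajectory_radius) => _ [s /= sI <-].
  have sab : a <= s <= b by move: sI; rewrite in_itv.
  apply: (@le_trans _ _ `|xt s - xs s|).
    by rewrite ler_pdivrMr// ler_peMr// E1//; case/andP: sab.
  apply: row_norm_le => [|i]; first by rewrite addr_ge0.
  rewrite !mxE (_ : _ - _ = (xt s 0 i - xa 0 i) - (xs s 0 i - xa 0 i)); last by ring.
  apply: le_trans (ler_normB _ _) _; apply: lerD.
    exact: (trajectory_bounded xtT ntO).
  exact: (trajectory_bounded xsT usO).
pose S := sup A.
have S_ub s : a <= s <= b -> `|xt s - xs s| <= S * E s.
  by move=> sab; rewrite -ler_pdivrMr//; apply: ub_le_sup => //; exact: gapS.
have S0 : 0 <= S.
  apply: (@le_trans _ _ (`|xt t - xs t| / E t)).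
    by rewrite divr_ge0// ltW.
  by apply: ub_le_sup => //; exact: gapS.
have step s : a <= s <= b -> `|xt s - xs s| <= (S / 2 + delta) * E s.
  move=> sab; apply: row_norm_le => [|i].
    by rewrite mulr_ge0 ?(ltW (E_gt0 s))// addr_ge0// divr_ge0.
  have [C1 [v1 C10 C1E]] := trajectory_volterra i xtT.
  have [C2 [v2 C20 C2E]] := trajectory_volterra i xsT.
  have vB := volterraB v1 v2.
  have B0 r : r < a -> (C1 \- C2) r = 0 by move=> ra /=; rewrite C10// C20// subrr.
  have KS0 : 0 <= K * S by rewrite mulr_ge0.
  have M20 : 0 <= 2 * M by rewrite mulr_ge0.
  have := volterra_gronwall (alpha01 i) sab scale_gt0 KS0 M20 theta_gt0 vB B0 (tau := tau).
  have [_ _ xta] := xtT; have [_ _ xsa] := xsT.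
  rewrite /= xta xsa subrr subr0 !mxE -/(E s) => H.
  apply: le_trans (H _) _; last first.
    rewrite mulrDr [leRHS]mulrDl. apply: lerD.
      rewrite (_ : kappa i * _ =
        kappa i * (K * (scale `^ alpha i * G i)) * (S * E s)); last by ring.
      rewrite (_ : S / 2 * E s = 2^-1 * (S * E s)); last by ring.
      by rewrite ler_wpM2r ?contraction// mulr_ge0// ltW.
    apply: le_trans (source i) _; rewrite ler_peMr// E1//.
    by case/andP: sab.
  apply: (@filterS3 _ _ (ae_filter_ringOfSetsType _) _ _ _ _ _ C1E C2E usO).
  move=> r H1 H2 Our rab; have rI : r \in `[a, b] by rewrite in_itv.
  rewrite /= H1// H2// indicE mem_setE; move: (Our rI) => {}Our.
  have -> : f r (xt r) (needle us tau v theta r) 0 i - f r (xs r) (us r) 0 i =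
    (f r (xt r) (needle us tau v theta r) - f r (xs r) (us r)) 0 i by rewrite !mxE.
  apply: le_trans (row_entry_le _ _) _; rewrite /needle; case: ifPn => rtau.
    apply: ler_wpDl; first by rewrite !mulr_ge0// ltW.
    rewrite mulr1 mulr_natl mulr2n; apply: le_trans (ler_normB _ _) _.
    by apply: lerD; exact: fM.
  rewrite mulr0 addr0 -mulrA; apply: (@le_trans _ _ (K * `|xt r - xs r|)).
    apply: fK => //; first exact: (trajectory_bounded xtT ntO).
    exact: (trajectory_bounded xsT usO).
  by rewrite ler_wpM2l// S_ub.
have Sle : S <= S / 2 + delta.
  apply: ge_sup; first by exists (`|xt t - xs t| / E t); exact: gapS.
  move=> _ [s /= sI <-]; rewrite ler_pdivrMr//; apply: step.
  by move: sI; rewrite in_itv.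
have S2 : S <= 2 * delta by lra.
apply: le_trans (S_ub _ tab) _; apply: ler_pM => //; first exact: ltW.
rewrite /E ler_expR ler_wpM2r ?invr_ge0 ?(ltW scale_gt0)//.
by rewrite lerB//; case/andP: tab.
Qed.

End gap.
End trajectories.

Theorem lemma3 (R : realType) (n m : nat) (a b : R) (alpha : 'I_n -> R)
    (L : R -> 'rV[R]_n -> 'rV[R]_m -> R)
    (f : R -> 'rV[R]_n -> 'rV[R]_m -> 'rV[R]_n)
    (phi : R -> 'rV[R]_n -> R)
    (Omega : set 'rV[R]_m) (xa : 'rV[R]_n)
    (xs : R -> 'rV[R]_n) (us : R -> 'rV[R]_m)
    (tau : R) (v : 'rV[R]_m) (xt : R -> R -> 'rV[R]_n) :
  a < b ->
  (forall i, 0 < alpha i < 1) ->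
  closed Omega ->
  C1_strip a b phi ->
  standing_assumptions a b Omega L ->
  standing_assumptions a b Omega f ->
  optimal a b alpha L f phi Omega xa xs us ->
  a <= tau < b ->
  lebesgue_pt_itv a b (fun t => f t (xs t) (us t)) tau ->
  lebesgue_pt_itv a b (fun t => L t (xs t) (us t)) tau ->
  Omega v ->
  (forall theta, 0 <= theta < b - tau ->
     state_trajectory a b alpha f xa (needle us tau v theta) (xt theta)) ->
  {uniform `[a, b], xt theta @[theta --> 0^'+] --> xs}.
Proof.
move=> ab alpha01 _ _ _ [_ _ fLip _ [M M0 fM]] [[_ xsT usO] _] /andP[atau taub] _ _ Ov xtT.
(* All trajectories take their values in the compact box B around xa, whence a
   Lipschitz constant K of f that serves all of them. *)
pose r := trajectory_radius a b alpha M.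
pose B := [set y : 'rV[R]_n | forall i, `[xa 0 i - r, xa 0 i + r]%classic (y ord0 i)].
have cB : compact B.
  apply: (@rV_compact _ _ (fun i => `[xa 0 i - r, xa 0 i + r]%classic)) => i.
  exact: segment_compact.
have BP (y : 'rV[R]_n) : (forall i, `|y 0 i - xa 0 i| <= r) -> B y.
  move=> H i; rewrite /= in_itv/=; have := H i.
  by rewrite ler_distl.
have [K K0 fK] := fLip B cB.
have fK' (x y : 'rV[R]_n) t u : (forall i, `|x 0 i - xa 0 i| <= r) ->
    (forall i, `|y 0 i - xa 0 i| <= r) ->
    t \in `[a, b] -> Omega u -> `|f t x u - f t y u| <= K * `|x - y|.
  by move=> /BP Bx /BP By tI Ou; exact: fK.
have G0 i : 0 <= Gamma (alpha i).
  by apply/ltW/Gamma_gt0; have /andP[-> /ltW] := alpha01 i.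
have al0 i : 0 < alpha i by have /andP[] := alpha01 i.
have k0 i : 0 <= volterra_const (alpha i) by exact: volterra_const_ge0.
(* The scale is fixed first: the contraction requirement does not involve theta. *)
have nearx : \forall x \near 0^'+, forall i,
    volterra_const (alpha i) * (K * (x `^ alpha i * Gamma (alpha i))) <= 2^-1.
  apply: filter_forall => i.
  have c0 : 0 <= volterra_const (alpha i) * K * Gamma (alpha i).
    by rewrite mulr_ge0// mulr_ge0// ltW.
  have h0 : 0 < 2^-1 :> R by rewrite invr_gt0.
  have := near_powR_le (al0 i) c0 h0; apply: filterS => x.
  by apply: le_trans; rewrite le_eqVlt; apply/orP; left; apply/eqP; ring.
have [scale [scale_gt0 contraction]] := filter_ex (filterI (nbhs_right_gt (0:R)) nearx).
move=> P /uniform_nbhs[E [/= entE EP]].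
have [e /= e0 eE] : exists2 e : R, 0 < e &
    forall x y : 'rV[R]_n, `|x - y| < e -> E (x, y).
  move: entE; rewrite -entourage_ballE => -[e /= e0 eE]; exists e => // x y xy.
  by apply: eE; rewrite /= -ball_normE.
pose c := expR ((b - a) / scale).
have c_gt0 : 0 < c by exact: expR_gt0.
(* [needle_gap] yields the bound 2 * delta * c, which is e / 2 < e here. *)
pose delta := e / (4 * c).
have delta0 : 0 < delta by rewrite divr_gt0// mulr_gt0.
have neart : \forall theta \near 0^'+, forall i,
    volterra_const (alpha i) *
      (2 * M * (theta `^ alpha i * (1 + expR 1 * Gamma (alpha i)))) <= delta.
  apply: filter_forall => i.
  have c0 : 0 <= volterra_const (alpha i) * (2 * M * (1 + expR 1 * Gamma (alpha i))).
    by rewrite mulr_ge0// mulr_ge0 ?mulr_ge0 ?(ltW M0)// addr_ge0// mulr_ge0// expR_ge0.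
  have := near_powR_le (al0 i) c0 delta0; apply: filterS => x.
  by apply: le_trans; rewrite le_eqVlt; apply/orP; left; apply/eqP; ring.
have btau : 0 < b - tau by rewrite subr_gt0.
near=> theta; apply: EP => t /= tI; apply: eE.
have theta_gt0 : 0 < theta by near: theta; exact: nbhs_right_gt.
have theta_lt : theta < b - tau by near: theta; exact: nbhs_right_lt.
have tab : a <= t <= b by move: tI; rewrite in_itv.
rewrite distrC.
have source : forall i, volterra_const (alpha i) *
    (2 * M * (theta `^ alpha i * (1 + expR 1 * Gamma (alpha i)))) <= delta.
  by near: theta.
have xtheta := xtT theta.
rewrite (ltW theta_gt0) theta_lt in xtheta.
apply: (le_lt_trans (needle_gap ab alpha01 (ltW M0) fM (ltW K0) fK' scale_gt0 contraction
  (ltW delta0) theta_gt0 source Ov xsT usO (xtheta isT) tab)).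
rewrite -/c /delta (_ : 2 * (e / (4 * c)) * c = e / 2); first by lra.
by field; rewrite gt_eqF.
Unshelve. all: by end_near. Qed.
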